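(* Let $q\in\mathbb{C}\setminus\{0\}$ and let $\mathcal{A}$ be a unital associative $\mathbb{C}$-algebra. Let $\Omega_q(\mathcal{A})=\mathcal{A}\otimes T(\mathcal{E})$ be the graded vector space with its $(\mathcal{A},T(\mathcal{E}))$-bimodule structure and its endomorphism $d$ of degree $1$ described in the context. Then there is a unique associative product on $\Omega_q(\mathcal{A})$ which extends its structure of $(\mathcal{A},T(\mathcal{E}))$-bimodule, for which $\Omega_q(\mathcal{A})$ is a graded algebra and for which $d$ satisfies the $q$-Leibniz rule $d(\alpha\beta)=d(\alpha)\beta+q^{a}\alpha\,d(\beta)$ for all $\alpha$ homogeneous of degree $a$ and all $\beta$ in $\Omega_q(\mathcal{A})$. Equipped with this product and with $d$, $\Omega_q(\mathcal{A})$ is a graded $q$-differential algebra (in particular $d^N=0$ if $q$ is a root of unity and $N$ is the smallest strictly positive integer with $q^N=1$).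
   Context: Tensor products are over $\mathbb{C}$; $\mathbb{N}=\{0,1,2,\dots\}$. Graded $q$-differential algebra: an $\mathbb{N}$-graded unital associative $\mathbb{C}$-algebra $\mathfrak{A}=\bigoplus_{n\in\mathbb{N}}\mathfrak{A}^n$ equipped with a linear endomorphism $d$, homogeneous of degree $1$, satisfying the $q$-Leibniz rule $d(\alpha\beta)=d(\alpha)\beta+q^a\alpha\, d(\beta)$ for all $\alpha\in\mathfrak{A}^a$, $\beta\in\mathfrak{A}$, and such that $d^N=0$ whenever $q^N=1$ with $N\in\mathbb{N}$, $N\neq 0$. Construction. Let $1$ be the unit of $\mathcal{A}$. If $q$ is a root of unity, let $N$ be the smallest strictly positive integer with $q^N=1$; otherwise set $N=\infty$. For each integer $k$ with $1\le k\le N-1$ (all $k\geq 1$ if $N=\infty$) let $d^k(\mathcal{A})$ be a copy of the vector space $\mathcal{A}/\mathbb{C}1$, with canonical projection $d^k:\mathcal{A}\rightarrow d^k(\mathcal{A})$, where $d^1=d$. Let $\mathcal{E}=\bigoplus_{k=1}^{N-1}d^k(\mathcal{A})$, graded by giving degree $k$ to $d^k(\mathcal{A})$. Define $d:\mathcal{E}\to\mathcal{E}$ by letting $d:d^k(\mathcal{A})\to d^{k+1}(\mathcal{A})$ be the canonical isomorphism ($d(d^k(x))=d^{k+1}(x)$) for $1\le k$, $k+1\le N-1$, and $d=0$ on $d^{N-1}(\mathcal{A})$ when $N<\infty$. (If $N=1$, then $\mathcal{E}=0$ and $d=0$.) Let $T(\mathcal{E})$ be the tensor algebra of $\mathcal{E}$,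 with the grading induced by that of $\mathcal{E}$, and extend $d$ to $T(\mathcal{E})$ as the unique extension satisfying the $q$-Leibniz rule; $T(\mathcal{E})$ is then a graded $q$-differential algebra. Put $\Omega_q(\mathcal{A})=\mathcal{A}\otimes T(\mathcal{E})$, graded by $\deg(x\otimes t)=\deg(t)$, which is a left $\mathcal{A}$-module via $y(x\otimes t)=yx\otimes t$ and a right $T(\mathcal{E})$-module via $(x\otimes t)t'=x\otimes tt'$. Identify $\mathcal{A}$ with $\mathcal{A}\otimes 1$ and $T(\mathcal{E})$ with $1\otimes T(\mathcal{E})$ in $\Omega_q(\mathcal{A})$, and define $d$ on $\Omega_q(\mathcal{A})$ by $d(x\otimes t)=1\otimes d(x)t+x\otimes d(t)$ for $x\in\mathcal{A}$, $t\in T(\mathcal{E})$. A product extends the $(\mathcal{A},T(\mathcal{E}))$-bimodule structure if left multiplication by an element $y\in\mathcal{A}=\mathcal{A}\otimes 1$ is given by $y(x\otimes t)=yx\otimes t$ and right multiplication by an element $t'\in T(\mathcal{E})=1\otimes T(\mathcal{E})$ is given by $(x\otimes t)t'=x\otimes tt'$, for all $x\in\mathcal{A}$, $t\in T(\mathcal{E})$. *)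

(* Defs.v *)
From HB Require Import structures.
From mathcomp Require Import all_boot all_order all_algebra.
From mathcomp Require Import generic_quotient ring_quotient.
From mathcomp Require Import boolp functions reals complex.
From mathcomp Require Import finmap monalg.

Set Implicit Arguments.
Unset Strict Implicit.
Unset Printing Implicit Defensive.

Import GRing.Theory.
Local Open Scope ring_scope.
Local Open Scope quotient_scope.

Section Span.
Variables (K : fieldType) (V : lmodType K).
Implicit Type S : V -> Prop.

Inductive span S : V -> Prop :=
| span0 : span S 0
| spanD a u v : S u -> span S v -> span S (a *: u + v).

Lemma span_submod S a u v : span S u -> span S v -> span S (a *: u + v).
Proof.
move=> Su Sv; elim: Su => [|b x y Sx _ IH]; first by rewrite scaler0 add0r.
by rewrite scalerDr scalerA -addrA; apply: spanD.
Qed.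

Lemma span_gen S u : S u -> span S u.
Proof.
by move=> Su; rewrite -[u]addr0 -[u]scale1r; apply: spanD => //; exact: span0.
Qed.

Definition span_pred S : {pred V} := fun v => `[< span S v >].

Lemma span_predP S u : reflect (span S u) (u \in span_pred S).
Proof. exact: asboolP. Qed.

Lemma span_closed S : subsemimod_closed (span_pred S).
Proof.
apply: GRing.submod_closed_semi; split; first exact/span_predP/span0.
by move=> a u v /span_predP Su /span_predP Sv; exact/span_predP/span_submod.
Qed.

HB.instance Definition _ S :=
  GRing.isSubmodClosed.Build K V (span_pred S) (span_closed S).

(* The quotient space V / span S. *)
Definition lquot S : Type := Quotient.quot (span_pred S).

HB.instance Definition _ S := GRing.Zmodule.on (lquot S).

Definition lproj S (v : V) : lquot S := \pi_(Quotient.quot (span_pred S)) v.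

Lemma lproj_eq S u v : lproj S u = lproj S v <-> span S (u - v).
Proof.
split=> [E|/span_predP H]; last by move: H; rewrite Quotient.idealrBE => /eqP.
by apply/span_predP; rewrite Quotient.idealrBE; apply/eqP.
Qed.

Definition lrepr S (u : lquot S) : V := repr (u : Quotient.quot (span_pred S)).

Lemma lreprK S : cancel (@lrepr S) (lproj S).
Proof. by move=> u; rewrite /lproj /lrepr reprK. Qed.

Lemma lproj_zmod_morphism S : zmod_morphism (lproj S).
Proof. by move=> u v; rewrite /lproj; exact: (raddfB \pi_(Quotient.quot (span_pred S))). Qed.

HB.instance Definition _ S :=
  GRing.isZmodMorphism.Build V (lquot S) (lproj S) (@lproj_zmod_morphism S).

Definition lscale S (a : K) (u : lquot S) : lquot S := lproj S (a *: lrepr u).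

Lemma lscaleE S a v : lscale a (lproj S v) = lproj S (a *: v).
Proof.
apply/lproj_eq; rewrite -scalerBr -[_ *: _]addr0.
by apply: span_submod; [apply/lproj_eq; rewrite lreprK|exact: span0].
Qed.

Lemma lscaleA S a b (u : lquot S) : lscale a (lscale b u) = lscale (a * b) u.
Proof. by rewrite -[u]lreprK !lscaleE scalerA. Qed.

Lemma lscale1 S : left_id 1 (@lscale S).
Proof. by move=> u; rewrite -[u]lreprK lscaleE scale1r. Qed.

Lemma lscaleDr S : right_distributive (@lscale S) +%R.
Proof.
move=> a u v; rewrite -[u]lreprK -[v]lreprK !lscaleE.
by rewrite -!raddfD /= lscaleE scalerDr.
Qed.

Lemma lscaleDl S (u : lquot S) : {morph (@lscale S)^~ u : a b / a + b}.
Proof.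
by move=> a b; rewrite /= -(lreprK u) !lscaleE scalerDl raddfD.
Qed.

HB.instance Definition _ S := GRing.Zmodule_isLmodule.Build K (lquot S)
  (@lscaleA S) (@lscale1 S) (@lscaleDr S) (@lscaleDl S).

Lemma lproj_scalable S : scalable (lproj S).
Proof. by move=> a v; rewrite -lscaleE. Qed.

HB.instance Definition _ S :=
  GRing.isScalable.Build K V (lquot S) *:%R (lproj S) (@lproj_scalable S).

Lemma lprojZ S a v : a *: lproj S v = lproj S (a *: v).
Proof. exact: lscaleE. Qed.

Lemma lproj_eq0 S v : lproj S v = 0 <-> span S v.
Proof. by rewrite -[v in span S v]subr0 -lproj_eq linear0. Qed.

Lemma lquotP S (Q : lquot S -> Prop) : (forall v, Q (lproj S v)) -> forall u, Q u.
Proof. by move=> H u; rewrite -[u]lreprK. Qed.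

End Span.

Section QuotientLift.
Variables (K : fieldType) (V W : lmodType K) (S : V -> Prop).

Lemma span_image (Q : W -> Prop) (f : {linear V -> W}) u :
  (forall v, S v -> span Q (f v)) -> span S u -> span Q (f u).
Proof.
move=> SQ; elim=> [|a x y Sx _ IH]; first by rewrite linear0; exact: span0.
by rewrite linearP; apply: span_submod => //; exact: SQ.
Qed.

Variables (f : {linear V -> W}) (fS : forall v, S v -> f v = 0).

Definition lquot_lift of (forall v, S v -> f v = 0) :=
  fun u : lquot S => f (lrepr u).

Lemma lquot_liftE v : lquot_lift fS (lproj S v) = f v.
Proof.
apply/eqP; rewrite -subr_eq0 -linearB; apply/eqP.
have : span S (lrepr (lproj S v) - v) by apply/lproj_eq; rewrite lreprK.
elim=> [|a x y /fS fx _ fy]; first exact: linear0.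
by rewrite linearP fx fy scaler0 addr0.
Qed.

Lemma lquot_lift_linear : linear (lquot_lift fS).
Proof.
move=> a u v; rewrite -[u]lreprK -[v]lreprK -(linearP (lproj S)) !lquot_liftE.
exact: linearP.
Qed.

HB.instance Definition _ :=
  GRing.isLinear.Build K (lquot S) W *:%R (lquot_lift fS) lquot_lift_linear.

End QuotientLift.

Section FreeModule.
Variables (K : fieldType) (X : choiceType).
Local Notation F := {malg K[X]}.

Lemma malgZU (c : K) (x : X) : << c *g x >> = c *: << x >> :> F.
Proof. by apply/malgP => y; rewrite mcoeffZ !mcoeffU mulrnAr mulr1. Qed.

Lemma malg_ind (P : F -> Prop) :
  P 0 -> (forall a u v, P u -> P v -> P (a *: u + v)) ->
  (forall x, P << x >>) -> forall g, P g.
Proof.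
move=> P0 PD PX g; rewrite [g]monalgE.
apply: (big_ind P) => // [u v Pu Pv|x _]; first by rewrite -[u]scale1r; apply: PD.
by rewrite malgZU -[_ *: _]addr0; apply: PD.
Qed.

Variable W : lmodType K.

Definition malg_ext (h : X -> W) (g : F) : W := \sum_(x <- msupp g) g@_x *: h x.

Lemma malg_extEw (h : X -> W) (d : {fset X}) g : (msupp g `<=` d)%fset ->
  malg_ext h g = \sum_(x <- d) g@_x *: h x.
Proof.
move=> le; rewrite /malg_ext (big_fset_incl _ le) //= => x xd /mcoeff_outdom ->.
by rewrite scale0r.
Qed.

Lemma malg_extU h x : malg_ext h << x >> = h x.
Proof. by rewrite (malg_extEw _ (msuppU_le)) big_seq_fset1 mcoeffUU scale1r. Qed.

Lemma malg_ext_linear h : linear (malg_ext h).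
Proof.
move=> a u v; pose d := (msupp u `|` msupp v)%fset.
have ud : (msupp u `<=` d)%fset by exact: fsubsetUl.
have vd : (msupp v `<=` d)%fset by exact: fsubsetUr.
have wd : (msupp (a *: u + v) `<=` d)%fset.
  apply: fsubset_trans (msuppD_le _ _) _; rewrite fsubUset vd andbT.
  exact: fsubset_trans (msuppZ_le _ _) ud.
rewrite (malg_extEw _ wd) (malg_extEw _ ud) (malg_extEw _ vd) scaler_sumr -big_split.
by apply: eq_bigr => x _ /=; rewrite mcoeffD mcoeffZ scalerDl scalerA.
Qed.

HB.instance Definition _ h :=
  GRing.isLinear.Build K F W *:%R (malg_ext h) (malg_ext_linear h).

End FreeModule.

Section TensorProduct.
Variables (K : fieldType) (U V : lmodType K).
Local Notation F := {malg K[(U * V)%type]}.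

Inductive tensor_rel : F -> Prop :=
| tensor_rel_l a x x' y :
    tensor_rel (<< (a *: x + x', y) >> - (a *: << (x, y) >> + << (x', y) >>))
| tensor_rel_r a x y y' :
    tensor_rel (<< (x, a *: y + y') >> - (a *: << (x, y) >> + << (x, y') >>)).

Definition tensor : Type := lquot tensor_rel.
HB.instance Definition _ := GRing.Lmodule.on tensor.

Definition otimes (x : U) (y : V) : tensor := lproj tensor_rel << (x, y) >>.

Lemma otimes_linear_l y : linear (otimes^~ y).
Proof.
move=> a x x'; apply/eqP; rewrite -subr_eq0 /otimes -linearP -linearB; apply/eqP.
by apply/lproj_eq0/span_gen/tensor_rel_l.
Qed.

Lemma otimes_linear_r x : linear (otimes x).
Proof.
move=> a y y'; apply/eqP; rewrite -subr_eq0 /otimes -linearP -linearB; apply/eqP.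
by apply/lproj_eq0/span_gen/tensor_rel_r.
Qed.

HB.instance Definition _ x :=
  GRing.isLinear.Build K V tensor *:%R (otimes x) (otimes_linear_r x).

Lemma tensor_ind (P : tensor -> Prop) :
  P 0 -> (forall a u v, P u -> P v -> P (a *: u + v)) ->
  (forall x y, P (otimes x y)) -> forall u, P u.
Proof.
move=> P0 PD PX u; rewrite -[u]lreprK; elim/malg_ind: (lrepr u).
- by rewrite linear0.
- by move=> a v w Pv Pw; rewrite linearP; apply: PD.
- by case.
Qed.

Variables (W : lmodType K) (h : U -> V -> W).
Hypotheses (hl : forall y, linear (h^~ y)) (hr : forall x, linear (h x)).

Lemma tensor_lift_rel u :
  tensor_rel u -> malg_ext (fun p => h p.1 p.2) u = 0.
Proof.
by case=> [a x x' y|a x y y'];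
  rewrite linearB /= linearP /= !malg_extU /= (hl, hr) subrr.
Qed.

Definition tensor_lift : tensor -> W := lquot_lift tensor_lift_rel.

Lemma tensor_liftE x y : tensor_lift (otimes x y) = h x y.
Proof. by rewrite /tensor_lift lquot_liftE /= malg_extU. Qed.

Lemma tensor_lift_linear : linear tensor_lift.
Proof. by move=> a u v; rewrite /tensor_lift linearP. Qed.

HB.instance Definition _ :=
  GRing.isLinear.Build K tensor W *:%R tensor_lift tensor_lift_linear.

End TensorProduct.

Lemma mulB2 (B : pzRingType) (a b x y : B) :
  a * b - x * y = (a - x) * b + x * (b - y).
Proof. by rewrite mulrBl mulrBr subrKA. Qed.

Section TensorAlgebra.
Variables (K : fieldType) (V : lmodType K).
Local Notation F := {malg K[{fmonom V}]}.

Definition fgen (e : V) : F := << fmu e >>.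

Definition fword (w : seq V) : F := \prod_(e <- w) fgen e.

Lemma fwordE (m : {fmonom V}) : << m >> = fword m.
Proof.
case: m => w /=; rewrite /fword; elim: w => [|e w IH].
  by rewrite big_nil -mpolyC1E; congr (<< _ >>); rewrite /mone /= fmoneE.
rewrite big_cons -IH /fgen malgM_def fgmulUU mulr1; congr (<< _ >>).
by rewrite /mmul /= fmmulE fmuE.
Qed.

Lemma fwordK w : exists m : {fmonom V}, fword w = << m >> /\ m = w :> seq V.
Proof. by exists (FMonom w); rewrite fwordE. Qed.

Lemma malg_ext_fword (W : lmodType K) (h : seq V -> W) (w : seq V) :
  malg_ext (fun m : {fmonom V} => h m) (fword w) = h w.
Proof. by have [m [-> <-]] := fwordK w; rewrite malg_extU. Qed.

Lemma fword_ind (P : F -> Prop) :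
  P 0 -> (forall a u v, P u -> P v -> P (a *: u + v)) ->
  (forall w, P (fword w)) -> forall g, P g.
Proof. by move=> P0 PD PX; apply: malg_ind => // m; rewrite fwordE. Qed.

Lemma mulr_malgC a (x : F) : x * a%:MP = a *: x.
Proof.
elim/malg_ind: x => [|b u v IHu IHv|m]; first by rewrite mul0r scaler0.
  by rewrite mulrDl -scalerAl IHu IHv scalerDr !scalerA mulrC.
by rewrite malgM_def fgmulUU mul1r mulm1 malgZU.
Qed.

Lemma malg_scalerAr a (x y : F) : a *: (x * y) = x * (a *: y).
Proof. by rewrite scalerAl -mulr_malgC -mulrA mul_malgC. Qed.

Definition lin_rel (a : K) (e f : V) : F :=
  fgen (a *: e + f) - (a *: fgen e + fgen f).

Inductive tens_rel : F -> Prop :=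
| tens_rel_lin x y a e f : tens_rel (x * lin_rel a e f * y).

Lemma mulF_linear_l (y : F) : linear ( *%R^~ y).
Proof. by move=> a u v; rewrite /= mulrDl -scalerAl. Qed.

Lemma mulF_linear_r (x : F) : linear ( *%R x).
Proof. by move=> a u v; rewrite mulrDr -malg_scalerAr. Qed.

Lemma tens_rel_mull z u : span tens_rel u -> span tens_rel (z * u).
Proof.
elim=> [|a t v St _ IH]; first by rewrite mulr0; exact: span0.
rewrite (mulF_linear_r z a t v); refine (span_submod _ _ IH).
by case: St => x y b e f; rewrite !(mulrA z); apply: span_gen; exact: tens_rel_lin.
Qed.

Lemma tens_rel_mulr z u : span tens_rel u -> span tens_rel (u * z).
Proof.
elim=> [|a t v St _ IH]; first by rewrite mul0r; exact: span0.
rewrite (mulF_linear_l z a t v); refine (span_submod _ _ IH).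
by case: St => x y b e f; rewrite -(mulrA _ y z); apply: span_gen; exact: tens_rel_lin.
Qed.

(* The quotient of the free algebra on the set V by the two-sided ideal which
   makes fgen linear. *)
Definition tens : Type := lquot tens_rel.
HB.instance Definition _ := GRing.Lmodule.on tens.

Local Notation pi := (lproj tens_rel : F -> tens).

Definition tens_one : tens := pi 1.
Definition tens_mul (u v : tens) : tens := pi (lrepr u * lrepr v).

Lemma tens_mulE x y : tens_mul (pi x) (pi y) = pi (x * y).
Proof.
apply/lproj_eq; rewrite mulB2 -[X in X + _]scale1r; apply: span_submod.
  by apply: tens_rel_mulr; apply/lproj_eq; rewrite lreprK.
by apply: tens_rel_mull; apply/lproj_eq; rewrite lreprK.
Qed.

Lemma tens_mulA : associative tens_mul.
Proof.
by elim/lquotP=> x; elim/lquotP=> y; elim/lquotP=> z; rewrite !tens_mulE mulrA.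
Qed.

Lemma tens_mul1 : left_id tens_one tens_mul.
Proof. by elim/lquotP=> x; rewrite tens_mulE mul1r. Qed.

Lemma tens_mulr1 : right_id tens_one tens_mul.
Proof. by elim/lquotP=> x; rewrite tens_mulE mulr1. Qed.

Lemma tens_mulDl : left_distributive tens_mul +%R.
Proof.
elim/lquotP=> x; elim/lquotP=> y; elim/lquotP=> z.
by rewrite -(raddfD (lproj _)) !tens_mulE -(raddfD (lproj _)) mulrDl.
Qed.

Lemma tens_mulDr : right_distributive tens_mul +%R.
Proof.
elim/lquotP=> x; elim/lquotP=> y; elim/lquotP=> z.
by rewrite -(raddfD (lproj _)) !tens_mulE -(raddfD (lproj _)) mulrDr.
Qed.

Lemma tens_one_neq0 : tens_one != 0.
Proof.
suff H (u : F) : span tens_rel u -> u@_(mone : {fmonom V}) = 0.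
  by apply/eqP => /lproj_eq0/H/eqP; rewrite mcoeff1 eqxx oner_eq0.
elim=> [|a _ v [x y b e f] _ IH]; first by rewrite mcoeff0.
rewrite mcoeffD mcoeffZ IH addr0.
have M (g g' : F) : (g * g')@_(mone : {fmonom V}) = g@_(mone : {fmonom V}) * g'@_(mone : {fmonom V}).
  exact: (rmorphM (mcoeff (mone : {fmonom V}))).
have U e' : (fgen e')@_(mone : {fmonom V}) = 0 by rewrite mcoeffU1 /mone /= fmoneE fmuE.
by rewrite !M /lin_rel mcoeffB mcoeffD mcoeffZ !U !(mulr0, addr0, subr0, mul0r).
Qed.

HB.instance Definition _ := GRing.Zmodule_isNzRing.Build tens
  tens_mulA tens_mul1 tens_mulr1 tens_mulDl tens_mulDr tens_one_neq0.

Lemma tensM x y : pi x * pi y = pi (x * y) :> tens.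
Proof. exact: tens_mulE. Qed.

Lemma tens_projD x y : pi (x + y) = pi x + pi y.
Proof. exact: raddfD. Qed.

Lemma tens_scalerAl a (u v : tens) : a *: (u * v) = (a *: u) * v.
Proof.
elim/lquotP: u => x; elim/lquotP: v => y.
by rewrite [a *: pi x]lprojZ /GRing.mul /= !tens_mulE lprojZ scalerAl.
Qed.

HB.instance Definition _ :=
  GRing.Lmodule_isLalgebra.Build K tens tens_scalerAl.

Lemma tens_scalerAr a (u v : tens) : a *: (u * v) = u * (a *: v).
Proof.
elim/lquotP: u => x; elim/lquotP: v => y.
by rewrite [a *: pi y]lprojZ /GRing.mul /= !tens_mulE lprojZ malg_scalerAr.
Qed.

HB.instance Definition _ := GRing.Lalgebra_isAlgebra.Build K tens tens_scalerAr.

Definition tgen (e : V) : tens := pi (fgen e).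

Lemma tgen_linear : linear tgen.
Proof.
move=> a e f; apply/eqP; rewrite -subr_eq0 /tgen -linearP -linearB; apply/eqP.
apply/lproj_eq0/span_gen; rewrite -[X in tens_rel X]mulr1 -[X in tens_rel (X * _)]mul1r.
exact: tens_rel_lin.
Qed.

HB.instance Definition _ :=
  GRing.isLinear.Build K V tens *:%R tgen tgen_linear.

End TensorAlgebra.

Lemma word_der_aux (B : pzRingType) (a b u v x y z : B) :
  a * (u * v) + b * (x * v + y * z) = (a * u + b * x) * v + b * y * z.
Proof. by rewrite mulrDr mulrDl !mulrA addrA. Qed.

Lemma linear2_l (K : fieldType) (B : lalgType K) a (p q r t y z : B) :
  (a *: p + q) * y + (a *: r + t) * z = a *: (p * y + r * z) + (q * y + t * z).
Proof. by rewrite !mulrDl -!scalerAl scalerDr addrACA. Qed.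

Lemma linear2_r (K : fieldType) (B : lalgType K) :
  (forall a (x y : B), a *: (x * y) = x * (a *: y)) ->
  forall a (p q r t y z : B),
  y * (a *: p + q) + z * (a *: r + t) = a *: (y * p + z * r) + (y * q + z * t).
Proof. by move=> H a p q r t y z; rewrite !mulrDr -!H scalerDr addrACA. Qed.

(* The extension of a linear d : V -> V to the tensor algebra as a derivation
   twisted by the algebra endomorphism induced by a linear s : V -> V,
     d (u v) = d u v + s u d v.
   With s = q ^+ k on elements of degree k this is the q-Leibniz rule. *)
Section TwistedDerivation.
Variables (K : fieldType) (V : lmodType K) (s d : {linear V -> V}).
Local Notation F := {malg K[{fmonom V}]}.
Local Notation pi := (lproj (@tens_rel K V)).

Fixpoint word_der (w : seq V) : F :=
  if w is e :: w' then fgen (d e) * fword w' + fgen (s e) * word_der w' else 0.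

Definition fsc : F -> F := malg_ext (fun m : {fmonom V} => fword (map s m)).
HB.instance Definition _ := GRing.Linear.on fsc.

Definition fder : F -> F := malg_ext (fun m : {fmonom V} => word_der m).
HB.instance Definition _ := GRing.Linear.on fder.

Lemma fscP a u v : fsc (a *: u + v) = a *: fsc u + fsc v.
Proof. exact: linearP. Qed.

Lemma fderP a u v : fder (a *: u + v) = a *: fder u + fder v.
Proof. exact: linearP. Qed.

Lemma fscB u v : fsc (u - v) = fsc u - fsc v.
Proof. exact: linearB. Qed.

Lemma fderB u v : fder (u - v) = fder u - fder v.
Proof. exact: linearB. Qed.

Lemma fsc_word w : fsc (fword w) = fword (map s w).
Proof. exact: (malg_ext_fword (fun w => fword (map s w))). Qed.

Lemma fder_word w : fder (fword w) = word_der w.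
Proof. exact: malg_ext_fword. Qed.

Lemma fword_cat (w w' : seq V) : fword (w ++ w') = fword w * fword w' :> F.
Proof. exact: big_cat. Qed.

Lemma fword_cons (e : V) w : fword (e :: w) = fgen e * fword w :> F.
Proof. exact: big_cons. Qed.

Lemma fword_seq1 (e : V) : fgen e = fword [:: e] :> F.
Proof. by rewrite /fword big_seq1. Qed.

Lemma fsc_gen e : fsc (fgen e) = fgen (s e).
Proof. by rewrite fword_seq1 fsc_word /= -fword_seq1. Qed.

Lemma fder_gen e : fder (fgen e) = fgen (d e).
Proof.
by rewrite fword_seq1 fder_word /= mulr0 addr0 /fword big_nil mulr1.
Qed.

Lemma fword_ext2 (W : lmodType K) (h h' : F -> F -> W) :
  (forall y, linear (h^~ y)) -> (forall x, linear (h x)) ->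
  (forall y, linear (h'^~ y)) -> (forall x, linear (h' x)) ->
  (forall w w', h (fword w) (fword w') = h' (fword w) (fword w')) ->
  forall x y, h x y = h' x y.
Proof.
have L0 (f : F -> W) : linear f -> f 0 = 0.
  by move=> /(_ (-1) 0 0); rewrite !scaler0 addr0 scaleN1r addNr.
move=> hl hr hl' hr' E x y; elim/fword_ind: x => [|a u v IHu IHv|w].
- by rewrite (L0 (h^~ y)) // (L0 (h'^~ y)).
- by rewrite (hl y a u v) (hl' y a u v) IHu IHv.
elim/fword_ind: y => [|a u v IHu IHv|w']; last exact: E.
- by rewrite (L0 (h _)) // (L0 (h' _)).
- by rewrite (hr _ a u v) (hr' _ a u v) IHu IHv.
Qed.

Lemma fsc_mul x y : fsc (x * y) = fsc x * fsc y.
Proof.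
apply: (fword_ext2 (h := fun x y => fsc (x * y))
  (h' := fun x y => fsc x * fsc y)).
- by move=> z a u v; exact: (etrans (congr1 fsc (mulF_linear_l z a u v)) (fscP a (u * z) (v * z))).
- by move=> z a u v; exact: (etrans (congr1 fsc (mulF_linear_r z a u v)) (fscP a (z * u) (z * v))).
- by move=> z a u v; rewrite (fscP a u v); exact: (mulF_linear_l (fsc z) a (fsc u) (fsc v)).
- by move=> z a u v; rewrite (fscP a u v); exact: (mulF_linear_r (fsc z) a (fsc u) (fsc v)).
by move=> w w'; rewrite -fword_cat !fsc_word map_cat fword_cat.
Qed.

Lemma fder_mul x y : fder (x * y) = fder x * y + fsc x * fder y.
Proof.
apply: (fword_ext2 (h := fun x y => fder (x * y))
  (h' := fun x y => fder x * y + fsc x * fder y)).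
- by move=> z a u v; exact: (etrans (congr1 fder (mulF_linear_l z a u v)) (fderP a (u * z) (v * z))).
- by move=> z a u v; exact: (etrans (congr1 fder (mulF_linear_r z a u v)) (fderP a (z * u) (z * v))).
- move=> z a u v; rewrite (fscP a u v) (fderP a u v).
  exact: (linear2_l a (fder u) (fder v) (fsc u) (fsc v) z (fder z)).
- move=> z a u v; rewrite (fderP a u v).
  exact: (linear2_r (@malg_scalerAr K V) a u v (fder u) (fder v) (fder z) (fsc z)).
move=> w w'; rewrite -fword_cat !fder_word fsc_word.
elim: w => [|e w IH] /=; first by rewrite mul0r add0r /fword big_nil mul1r.
rewrite fword_cons; move: IH (fword_cat w w') => -> ->.
exact: word_der_aux.
Qed.

Lemma fsc_lin_rel a e f : fsc (lin_rel a e f) = lin_rel a (s e) (s f).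
Proof. by rewrite /lin_rel fscB fscP !fsc_gen linearP. Qed.

Lemma fder_lin_rel a e f : fder (lin_rel a e f) = lin_rel a (d e) (d f).
Proof. by rewrite /lin_rel fderB fderP !fder_gen linearP. Qed.

Lemma fsc_rel u : tens_rel u -> span (@tens_rel K V) (fsc u).
Proof.
case=> x y a e f; rewrite (fsc_mul (x * _)) (fsc_mul x) fsc_lin_rel.
by apply: span_gen; exact: tens_rel_lin.
Qed.

Lemma fder_rel u : tens_rel u -> span (@tens_rel K V) (fder u).
Proof.
case=> x y a e f; rewrite (fder_mul (x * _)) (fder_mul x) (fsc_mul x).
rewrite fder_lin_rel fsc_lin_rel mulrDl.
have A u1 u2 : span (@tens_rel K V) u1 -> span (@tens_rel K V) u2 ->
    span (@tens_rel K V) (u1 + u2).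
  by move=> ? ?; rewrite -[u1]scale1r; exact: span_submod.
by apply: (A); [apply: (A)|]; apply: span_gen; exact: tens_rel_lin.
Qed.

Definition tsc : tens V -> tens V :=
  lquot_lift (f := pi \o fsc) (fun u Su => (lproj_eq0 _ _).2 (fsc_rel Su)).
HB.instance Definition _ := GRing.Linear.on tsc.

Definition tder : tens V -> tens V :=
  lquot_lift (f := pi \o fder) (fun u Su => (lproj_eq0 _ _).2 (fder_rel Su)).
HB.instance Definition _ := GRing.Linear.on tder.

Lemma tsc_gen e : tsc (tgen e) = tgen (s e).
Proof. by rewrite /tsc lquot_liftE /= fsc_gen. Qed.

Lemma tder_gen e : tder (tgen e) = tgen (d e).
Proof. by rewrite /tder lquot_liftE /= fder_gen. Qed.

Lemma tsc1 : tsc 1 = 1.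
Proof.
have N : fword [::] = 1 :> F by exact: big_nil.
transitivity (tsc (pi (fword [::]))); first by rewrite N.
by rewrite /tsc lquot_liftE /= fsc_word N.
Qed.

Lemma tsc_pi x : tsc (pi x) = pi (fsc x).
Proof. exact: lquot_liftE. Qed.

Lemma tder_pi x : tder (pi x) = pi (fder x).
Proof. exact: lquot_liftE. Qed.

Lemma tscM u v : tsc (u * v) = tsc u * tsc v.
Proof.
elim/lquotP: u => x; elim/lquotP: v => y.
by rewrite tensM !tsc_pi tensM fsc_mul.
Qed.

Lemma tderM u v : tder (u * v) = tder u * v + tsc u * tder v.
Proof.
elim/lquotP: u => x; elim/lquotP: v => y.
rewrite (tensM x y) (tder_pi (x * y)) (tder_pi x) (tder_pi y) (tsc_pi x).
by rewrite (tensM (fder x) y) (tensM (fsc x)) fder_mul (tens_projD (fder x * y)).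
Qed.

End TwistedDerivation.

Section GradedAlgebra.
Variables (K : fieldType) (V : lmodType K).
Implicit Types (gr : nat -> V -> Prop) (mul : V -> V -> V).

Definition bilinear_product mul : Prop :=
  (forall v, linear (mul^~ v)) /\ (forall u, linear (mul u)).

(* Unital associative algebra structures on V. Unlike for algType, V = 0 is
   allowed. *)
Record unital_algebra mul (one : V) : Prop := UnitalAlgebra {
  ua_bilinear : bilinear_product mul;
  ua_assoc : associative mul;
  ua_left_unit : left_id one mul;
  ua_right_unit : right_id one mul
}.

(* gr n is the homogeneous component of degree n: V is the internal direct sum
   of the subspaces gr n. *)
Record grading gr : Prop := Grading {
  grading0 : forall n, gr n 0;
  grading_linear : forall n a u v, gr n u -> gr n v -> gr n (a *: u + v);
  grading_decomposition : forall v, exists! x : nat -> V,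
    (forall n, gr n (x n)) /\
    (exists m, (forall n, (m <= n)%N -> x n = 0) /\ v = \sum_(n < m) x n)
}.

Definition graded_product gr mul : Prop :=
  forall a b u v, gr a u -> gr b v -> gr (a + b)%N (mul u v).

Definition q_leibniz (q : K) gr mul (d : V -> V) : Prop :=
  forall a u v, gr a u -> d (mul u v) = mul (d u) v + q ^+ a *: mul u (d v).

Record graded_qdiff_algebra (q : K) gr mul (one : V) (d : V -> V) : Prop :=
  GradedQDiffAlgebra {
    gqd_algebra : unital_algebra mul one;
    gqd_grading : grading gr;
    gqd_one : gr 0 one;
    gqd_mul : graded_product gr mul;
    gqd_linear : linear d;
    gqd_degree : forall n u, gr n u -> gr n.+1 (d u);
    gqd_leibniz : q_leibniz q gr mul d;
    gqd_nilpotent : forall N, (0 < N)%N -> q ^+ N = 1 -> forall u, iter N d u = 0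
  }.

End GradedAlgebra.

Section Omega.
Variables (K : fieldType) (q : K) (A : lmodType K) (oneA : A).

Local Notation Abar := (lquot (fun v : A => v = oneA)).
Local Notation abar := (lproj (fun v : A => v = oneA)).

(* 1 <= k <= N - 1 where N is the order of q, with N infinite if q is not a root
   of unity. *)
Definition in_range (k : nat) : bool :=
  (0 < k)%N && `[< forall N, N.-primitive_root q -> (k <= N.-1)%N >].

Definition E_pred : {pred nat -> Abar} := fun f =>
  `[< (forall k, ~~ in_range k -> f k = 0) /\
      (exists m, forall k, (m <= k)%N -> f k = 0) >].

(* The direct sum of copies of A / K 1 indexed by the k such that in_range k, as
   finitely supported families; the copy of index k is d^k(A). *)
Record Espace := MkEspace { E_val :> nat -> Abar; E_valP : E_val \in E_pred }.

HB.instance Definition _ := [isSub for E_val].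
HB.instance Definition _ := [Choice of Espace by <:].

Lemma E_closed : subsemimod_closed E_pred.
Proof.
apply: GRing.submod_closed_semi; split.
  by apply/asboolP; split=> //; exists 0%N.
move=> a f g /asboolP[f0 [m fm]] /asboolP[g0 [n gn]]; apply/asboolP; split=> [k kN|].
  by rewrite /= -[LHS]/(a *: f k + g k) f0 // g0 // scaler0 addr0.
exists (maxn m n) => k; rewrite geq_max => /andP[mk nk].
by rewrite -[LHS]/(a *: f k + g k) fm // gn // scaler0 addr0.
Qed.

HB.instance Definition _ := GRing.isSubmodClosed.Build K (nat -> Abar) E_pred E_closed.
HB.instance Definition _ := [SubChoice_isSubLmodule of Espace by <:].

Lemma E_linearE a (e f : Espace) k : (a *: e + f) k = a *: e k + f k.
Proof. by []. Qed.

Lemma E_ext (e f : Espace) : (forall k, e k = f k) -> e = f.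
Proof. by move=> H; apply/val_inj/funext. Qed.

(* d^k : A -> E; it is 0 unless in_range k. *)
Definition dk_fun (k : nat) (x : A) : nat -> Abar :=
  fun j => if (j == k) && in_range k then abar x else 0.

Lemma dk_subproof k x : dk_fun k x \in E_pred.
Proof.
apply/asboolP; split=> [j jN|]; rewrite /dk_fun.
  by case: eqP jN => [->|//] /negPf->.
by exists k.+1 => j; case: eqP => [->|//]; rewrite ltnn.
Qed.

Definition dk k x : Espace := MkEspace (dk_subproof k x).

Lemma dk_linear k : linear (dk k).
Proof.
move=> a x y; apply: E_ext => j; rewrite E_linearE /= /dk_fun.
by case: ifP => _; [exact: linearP|rewrite scaler0 addr0].
Qed.

HB.instance Definition _ k :=
  GRing.isLinear.Build K A Espace *:%R (dk k) (dk_linear k).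

(* Shift of the components by one; (Ed e) 1 = 0 because e 0 = 0, and the
   component of degree N - 1 is killed. *)
Definition Ed_fun (e : Espace) : nat -> Abar :=
  fun k => if in_range k then e k.-1 else 0.

Lemma Ed_subproof e : Ed_fun e \in E_pred.
Proof.
apply/asboolP; rewrite /Ed_fun; split=> [j /negPf-> //|].
case: e => f /= /asboolP[_ [m fm]]; exists m.+1 => -[//|k] mk.
by case: ifP => // _; apply: fm.
Qed.

Definition Ed (e : Espace) : Espace := MkEspace (Ed_subproof e).

Lemma Ed_linear : linear Ed.
Proof.
move=> a x y; apply: E_ext => j; rewrite E_linearE /= /Ed_fun.
by case: ifP => _; rewrite ?E_linearE // scaler0 addr0.
Qed.

HB.instance Definition _ := GRing.isLinear.Build K Espace Espace *:%R Ed Ed_linear.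

Lemma in_range_leq j k : (0 < j <= k)%N -> in_range k -> in_range j.
Proof.
case/andP=> j0 jk /andP[_ /asboolP H]; rewrite /in_range j0; apply/asboolP => N /H.
exact: leq_trans.
Qed.

Lemma Ed_dk k x : (0 < k)%N -> Ed (dk k x) = dk k.+1 x.
Proof.
move=> k0; apply: E_ext => -[|j] /=; rewrite /Ed_fun /dk_fun ?eqSS //=.
rewrite /dk_fun; case: eqP => [->|_] /=; last by case: ifP.
by case: ifP => //= /(in_range_leq (j := k)) ->; rewrite ?k0 /=.
Qed.

Definition Escale_fun (e : Espace) : nat -> Abar := fun k => q ^+ k *: e k.

Lemma Escale_subproof e : Escale_fun e \in E_pred.
Proof.
have /asboolP[f0 [m fm]] := E_valP e; apply/asboolP; rewrite /Escale_fun.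
by split=> [j /f0->|]; rewrite ?scaler0 //; exists m => k /fm ->; rewrite scaler0.
Qed.

Definition Escale (e : Espace) : Espace := MkEspace (Escale_subproof e).

Lemma Escale_linear : linear Escale.
Proof.
move=> a x y; apply: E_ext => j; rewrite E_linearE /= /Escale_fun E_linearE.
by rewrite scalerDr !scalerA mulrC.
Qed.

HB.instance Definition _ := GRing.isLinear.Build K Espace Espace *:%R Escale Escale_linear.

Definition Egr (k : nat) (e : Espace) : Prop := forall j, j != k -> e j = 0.

Local Notation TE := (tens Espace).

(* Spanned by the products of homogeneous elements of E of total degree n. *)
Definition Tgr (n : nat) : TE -> Prop := span (fun t => exists w : seq (nat * Espace),
  [/\ forall p, p \in w -> Egr p.1 p.2, (\sum_(p <- w) p.1)%N = n
    & t = \prod_(p <- w) tgen p.2]).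

Definition Td : TE -> TE := tder Escale Ed.
HB.instance Definition _ := GRing.Linear.on Td.

Lemma Td_gen (e : Espace) : Td (tgen e) = tgen (Ed e).
Proof. exact: tder_gen. Qed.

Lemma Td_leibniz n (t t' : TE) :
  Tgr n t -> Td (t * t') = Td t * t' + q ^+ n *: (t * Td t').
Proof.
suff H : Tgr n t -> tsc Escale t = q ^+ n *: t.
  by move/H => E; rewrite /Td tderM E -scalerAl.
have tscP a u v : tsc Escale (a *: u + v) = a *: tsc Escale u + tsc Escale v by exact: linearP.
have H0 (w : seq (nat * Espace)) : (forall p, p \in w -> Egr p.1 p.2) ->
    tsc Escale (\prod_(p <- w) tgen p.2) =
    q ^+ (\sum_(p <- w) p.1)%N *: \prod_(p <- w) tgen p.2.
  elim: w => [|[k e] w IHw] wgr; first by rewrite !big_nil scale1r tsc1.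
  rewrite !big_cons tscM tsc_gen /= IHw => [|p pw]; last first.
    by apply: wgr; rewrite inE pw orbT.
  have -> : Escale e = q ^+ k *: e.
    apply: E_ext => j; rewrite /= /Escale_fun -[RHS]/(q ^+ k *: e j).
    have [->//|jk] := eqVneq j k.
    by rewrite (wgr (k, e) (mem_head _ _)) ?scaler0.
  by rewrite linearZ /= -scalerAl -scalerAr scalerA exprD.
elim=> [|a _ v [w [/H0 Hw wn ->]] _ IH]; first by rewrite linear0 scaler0.
by rewrite tscP IH Hw wn scalerDr !scalerA mulrC.
Qed.

Definition Omega : Type := tensor A TE.
HB.instance Definition _ := GRing.Lmodule.on Omega.

Definition ot (x : A) (t : TE) : Omega := otimes x t.

Definition Ogr (n : nat) : Omega -> Prop :=
  span (fun u => exists x t, Tgr n t /\ u = ot x t).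

Definition Od_fun (x : A) (t : TE) : Omega :=
  ot oneA (tgen (dk 1 x) * t) + ot x (Td t).

Lemma Od_linear_l t : linear (Od_fun^~ t).
Proof.
move=> a x y; have E : tgen (dk 1 (a *: x + y)) * t =
    a *: (tgen (dk 1 x) * t) + tgen (dk 1 y) * t.
  by rewrite dk_linear tgen_linear mulrDl -scalerAl.
rewrite /Od_fun /ot E otimes_linear_r otimes_linear_l scalerDr; exact: addrACA.
Qed.

Lemma Od_linear_r x : linear (Od_fun x).
Proof.
move=> a t t'; have E : tgen (dk 1 x) * (a *: t + t') =
    a *: (tgen (dk 1 x) * t) + tgen (dk 1 x) * t'.
  by rewrite mulrDr -scalerAr.
have Tl : Td (a *: t + t') = a *: Td t + Td t' by exact: linearP.
rewrite /Od_fun /ot E Tl !otimes_linear_r scalerDr; exact: addrACA.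
Qed.

Definition Od : Omega -> Omega := tensor_lift Od_linear_l Od_linear_r.

Lemma Od_linear : linear Od.
Proof. exact: tensor_lift_linear. Qed.

HB.instance Definition _ :=
  GRing.isLinear.Build K Omega Omega *:%R Od Od_linear.

Lemma OdE x t : Od (ot x t) = ot oneA (tgen (dk 1 x) * t) + ot x (Td t).
Proof. exact: tensor_liftE. Qed.

(* The bimodule structure is y (x (x) t) t' = (y x) (x) (t t'). *)
Definition extends_bimodule (mulA : A -> A -> A) (mul : Omega -> Omega -> Omega) :
    Prop :=
  (forall y x t, mul (ot y 1) (ot x t) = ot (mulA y x) t) /\
  (forall x t t', mul (ot x t) (ot oneA t') = ot x (t * t')).

Definition Omega_product (mulA : A -> A -> A) (mul : Omega -> Omega -> Omega) :
    Prop :=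
  [/\ bilinear_product mul, associative mul, extends_bimodule mulA mul,
      graded_product Ogr mul & q_leibniz q Ogr mul Od].

End Omega.

Arguments Omega {K} q {A} oneA.
Arguments ot {K q A oneA} x t.
Arguments Ogr {K} q {A} oneA n u.
Arguments Od {K} q {A} oneA u.
Arguments Omega_product {K} q {A} oneA mulA mul.

(* Main.v *)
(** In any such algebra, left multiplications satisfy the q-Leibniz rule in
    operator form: L_(du) = d L_u - q^a L_u d for u of degree a.  Starting from
    the left multiplication l_x by x in A, this forces the operator of d^n(x) to
    be the n-fold graded q-commutator ad^n(l_x) of d with l_x, whence uniqueness.
    Conversely these operators kill x = 1, and they vanish for n >= N: since the
    q-binomials [N, i] vanish for 0 < i < N, both d^N and ad^N reduce to their
    two extreme terms, so that d^N = 0 on Omega and then ad^N(l_x) = 0.  Hence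
    they extend to a representation L of T(E) on Omega, and the product is
    (x (x) t) v = x L_t(v).  The operators X with (X u) v = X (u v) contain the
    l_x and are stable under composition and under the q-commutator with d,
    which gives associativity without any identity between q-multinomials. *)
Require Import Defs.
From HB Require Import structures.
From mathcomp Require Import all_boot all_order all_algebra.
From mathcomp Require Import reals complex.
From mathcomp Require Import ring boolp functions finmap monalg.

Set Implicit Arguments.
Unset Strict Implicit.
Unset Printing Implicit Defensive.

Import GRing.Theory.
Local Open Scope ring_scope.
Local Open Scope complex_scope.

(** * Maps given with a proof of linearity instead of a bundled structure *)

Section LinearFunctions.
Variables (K : fieldType) (U V : lmodType K) (f : U -> V).
Hypothesis f_lin : linear f.

Lemma lin0 : f 0 = 0.
Proof. by have := f_lin (-1) 0 0; rewrite !scaler0 addr0 scaleN1r addNr. Qed.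

Lemma linD u v : f (u + v) = f u + f v.
Proof. by have := f_lin 1 u v; rewrite !scale1r. Qed.

Lemma linZ a u : f (a *: u) = a *: f u.
Proof. by have := f_lin a u 0; rewrite lin0 !addr0. Qed.

Lemma linB u v : f (u - v) = f u - f v.
Proof. by rewrite linD -scaleN1r linZ scaleN1r. Qed.

Lemma lin_sum (I : Type) (r : seq I) (P : pred I) (F : I -> U) :
  f (\sum_(i <- r | P i) F i) = \sum_(i <- r | P i) f (F i).
Proof. by apply: (big_morph f linD lin0). Qed.

Lemma lin_span S (Q : V -> Prop) u :
  (forall v, S v -> Defs.span Q (f v)) -> Defs.span S u -> Defs.span Q (f u).
Proof.
move=> SQ; elim=> [|a x y /SQ Sx _ IH]; first by rewrite lin0; exact: Defs.span0.
by rewrite f_lin; exact: Defs.span_submod.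
Qed.

End LinearFunctions.

Lemma linear_comp (K : fieldType) (U V W : lmodType K) (g : V -> W) (f : U -> V) :
  linear g -> linear f -> linear (fun u => g (f u)).
Proof. by move=> gl fl a u v; rewrite fl gl. Qed.

Lemma linear_sub_scale (K : fieldType) (U V : lmodType K) c (f g : U -> V) :
  linear f -> linear g -> linear (fun u => f u - c *: g u).
Proof.
move=> fl gl a u v; rewrite fl gl (scalerDr c) !scalerA (mulrC c) -scalerA.
by rewrite scalerBr opprD addrACA.
Qed.

(** * Gaussian binomials at roots of unity *)

Section QBinomial.
Variables (K : fieldType) (q : K).

Fixpoint qbinom (n i : nat) : K :=
  match n, i with
  | _, 0 => 1
  | 0, _.+1 => 0
  | n'.+1, i'.+1 => qbinom n' i' + q ^+ i'.+1 * qbinom n' i'.+1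
  end.

Arguments qbinom : simpl never.

Lemma qbinom0 n : qbinom n 0 = 1. Proof. by case: n. Qed.

Lemma qbinomS n i :
  qbinom n.+1 i.+1 = qbinom n i + q ^+ i.+1 * qbinom n i.+1.
Proof. by []. Qed.

Lemma qbinom_small n i : (n < i)%N -> qbinom n i = 0.
Proof.
elim: n i => [[]//|n IH [//|i]]; rewrite ltnS => ni.
by rewrite qbinomS !IH ?mulr0 ?addr0 // leqW.
Qed.

Lemma qbinomn n : qbinom n n = 1.
Proof. by elim: n => // n IH; rewrite qbinomS IH qbinom_small ?mulr0 ?addr0. Qed.

(** Ratio of consecutive Gaussian binomials with denominators cleared, so that it also holds at
    roots of unity. *)
Lemma qbinom_next n i : (i <= n)%N ->
  (1 - q ^+ i.+1) * qbinom n i.+1 = (1 - q ^+ (n - i)) * qbinom n i.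
Proof.
elim: n i => [|n IH] i.
  by rewrite leqn0 => /eqP->; rewrite subnn expr0 subrr mulr0 mul0r.
move=> ni; case: (ltngtP i n.+1) ni => // [in_|->] _; last first.
  by rewrite (@qbinom_small _ n.+2) // subnn expr0 subrr mulr0 mul0r.
(* Absorption identity: the recurrence together with the induction hypothesis trades both lower
   indices for [n] and [i]. *)
have -> : (1 - q ^+ i.+1) * qbinom n.+1 i.+1 = (1 - q ^+ n.+1) * qbinom n i.
  rewrite qbinomS mulrDr mulrCA (IH i in_).
  have -> : q ^+ n.+1 = q ^+ i.+1 * q ^+ (n - i) by rewrite -exprD addSn subnKC.
  by ring.
case: i in_ => [|i] in_; first by rewrite subn0 !qbinom0.
rewrite subSS qbinomS mulrDr -IH 1?ltnW //.
have -> : q ^+ n.+1 = q ^+ i.+1 * q ^+ (n - i) by rewrite -exprD addSn subnKC // ltnW.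
by ring.
Qed.

(** Multiplied by [1 - q ^+ i], the binomial acquires the factor [1 - q ^+ N = 0]; and [q ^+ i] is
    not 1, because [i] lies strictly between 0 and the order of [q]. *)
Lemma qbinom_prim_root N i : N.-primitive_root q -> (0 < i < N)%N -> qbinom N i = 0.
Proof.
move=> qN; case: N qN => [|N] qN; case: i => // i /andP[_]; rewrite ltnS => iN.
have /eqP : (1 - q ^+ i.+1) * qbinom N.+1 i.+1 = 0.
  rewrite qbinomS mulrDr mulrCA (qbinom_next (ltnW iN)) mulrA -mulrDl.
  have : q ^+ i.+1 * q ^+ (N - i) = 1.
    by rewrite -exprD addSn subnKC ?(prim_expr_order qN) // ltnW.
  by move=> H; rewrite mulrBr mulr1 H subrKA subrr mul0r.
rewrite mulf_eq0 => /orP[|/eqP//]; rewrite subr_eq0 eq_sym -(expr0 q) => H.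
by move: H; rewrite (eq_prim_root_expr qN) /= mod0n modn_small.
Qed.

Variables (W : lmodType K) (T : nat -> W -> W) (f : nat -> nat -> W) (u : nat -> W).
Hypothesis T_lin : forall n, linear (T n).
Hypothesis T_f : forall i j, T (i + j) (f i j) = f i.+1 j + q ^+ i *: f i j.+1.
Hypothesis u0 : u 0%N = f 0 0.
Hypothesis uS : forall n, u n.+1 = T n (u n).

(** Abstract [q]-binomial formula: one step raises either index of [f i j], the second at the cost
    of [q ^+ i]. The step [T n] may depend on [n], which covers both powers of a twisted derivation
    on a product and iterated [q]-commutators, whose weights change at each step. *)
Lemma qbinom_expansion n : u n = \sum_(i < n.+1) qbinom n i *: f i (n - i).
Proof.
elim: n => [|n IH]; first by rewrite big_ord1 scale1r u0.
rewrite uS IH lin_sum // [RHS]big_ord_recl qbinom0 scale1r subn0.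
pose g i := qbinom n i *: f i.+1 (n - i).
pose h i := (q ^+ i * qbinom n i) *: f i (n.+1 - i).
have -> : \sum_(i < n.+1) T n (qbinom n i *: f i (n - i)) =
    \sum_(i < n.+1) g i + \sum_(i < n.+1) h i.
  rewrite -big_split; apply: eq_bigr => i _ /=.
  have le : (i <= n)%N by rewrite -ltnS.
  have := T_f i (n - i); rewrite subnKC // => Tf; rewrite linZ // Tf.
  rewrite scalerDr scalerA [qbinom n i * _]mulrC.
  by rewrite /h subSn.
(* Appending the null term [h n.+1] and detaching [h 0] aligns the two sums for the Pascal
   recurrence. *)
have -> : \sum_(i < n.+1) h i = f 0 n.+1 + \sum_(i < n.+1) h i.+1.
  have -> : \sum_(i < n.+1) h i = \sum_(i < n.+2) h i.
    by rewrite [RHS]big_ord_recr /= [h n.+1]/h qbinom_small // mulr0 scale0r addr0.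
  by rewrite big_ord_recl /= [h 0%N]/h qbinom0 mulr1 scale1r subn0.
rewrite addrCA -big_split; congr (_ + _); apply: eq_bigr => i _ /=.
by rewrite /g /h -scalerDl subSS.
Qed.

Lemma qbinom_prim_expansion N : N.-primitive_root q -> u N = f N 0 + f 0 N.
Proof.
move=> qN; rewrite qbinom_expansion; case: N qN => [/prim_order_gt0//|N] qN.
rewrite big_ord_recr big_ord_recl /= big1 => [|i _]; last first.
  by rewrite qbinom_prim_root ?scale0r // /bump /= ltnS ltn_ord.
by rewrite qbinomn qbinom0 !scale1r subnn subn0 addr0 addrC.
Qed.
End QBinomial.

(** * Graded q-commutators with a differential *)

(* For [d] twisted by [s], i.e. [d (u v) = d u v + s u d v], and [X] of degree 0,
   [qad X n] is the [n]-fold graded [q]-commutator of [d] with [X]. *)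
Section QCommutator.
Variables (K : fieldType) (q : K) (W : lmodType K) (d : W -> W).
Hypothesis d_lin : linear d.

Fixpoint qad (X : W -> W) (n : nat) : W -> W :=
  if n is m.+1 then fun u => d (qad X m u) - q ^+ m *: qad X m (d u) else X.

Lemma qadS X n u : qad X n.+1 u = d (qad X n u) - q ^+ n *: qad X n (d u).
Proof. by []. Qed.

Lemma qad_linear X n : linear X -> linear (qad X n).
Proof.
move=> Xl; elim: n => // n IH.
by apply: linear_sub_scale; [exact: linear_comp|exact: (linear_comp IH)].
Qed.

(** Makes the operator of [d^n(x)] depend linearly on [x], as an action of the copies of [A]
    requires. *)
Lemma qad_linear_param (V : lmodType K) (X : V -> W -> W) n u :
  (forall w, linear (X^~ w)) -> linear (fun x => qad (X x) n u).
Proof.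
move=> Xl; elim: n u => [|n IH] u; first exact: Xl.
by apply: linear_sub_scale => //; apply: linear_comp.
Qed.

Lemma qad_eq X Y n u : X =1 Y -> qad X n u = qad Y n u.
Proof. by move=> XY; elim: n u => [|n IH] u /=; rewrite ?XY // !IH. Qed.

(** The first commutator is [d - d], since [q ^+ 0 = 1]. This is why the operators of [d^k(x)]
    factor through the quotient of [A] by the unit. *)
Lemma qad_id n u : qad id n.+1 u = 0.
Proof.
elim: n u => [|n IH] u; first by rewrite qadS scale1r subrr.
by rewrite qadS !IH scaler0 (lin0 d_lin) subrr.
Qed.

(** The [q]-binomial formula is applied in the space of all maps [W -> W]; the two surviving terms,
    [d^N X] and a multiple of [X d^N], both vanish. *)
Lemma qad_prim X N u : linear X -> N.-primitive_root q ->
  (forall v, iter N d v = 0) -> qad X N u = 0.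
Proof.
move=> Xl qN dN.
pose T n (Y : W -> W) : W -> W := fun u => d (Y u) - q ^+ n *: Y (d u).
(* Moving the next [d] to the right of [X] costs [- q ^+ (i + j)]. The formula accounts for
   [q ^+ i]; the remaining factors [- q ^+ j] accumulate to [(-1) ^+ j * q ^+ 'C(j, 2)]. *)
pose f i j : W -> W :=
  fun u => ((-1) ^+ j * q ^+ 'C(j, 2)) *: iter i d (X (iter j d u)).
have T_lin n : linear (T n).
  move=> a Y Z; apply/funext => v.
  rewrite /T -[RHS]/(a *: T n Y v + T n Z v) /T.
  rewrite -[(a *: Y + Z) v]/(a *: Y v + Z v).
  rewrite -[(a *: Y + Z) (d v)]/(a *: Y (d v) + Z (d v)).
  by rewrite d_lin !scalerDr scalerN !scalerA (mulrC a) opprD addrACA.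
have T_f i j : T (i + j)%N (f i j) = f i.+1 j + q ^+ i *: f i j.+1.
  apply/funext => v; rewrite -[RHS]/(f i.+1 j v + q ^+ i *: f i j.+1 v) /T /f.
  rewrite (linZ d_lin) -iterS -iterSr; congr (_ + _); rewrite -scaleNr !scalerA.
  congr (_ *: _); rewrite binS bin1 !exprD exprS; ring.
have -> : qad X N = f N 0 + f 0 N.
  apply: (qbinom_prim_expansion T_lin T_f) => //.
  by apply/funext => v; rewrite /f /= mulr1 scale1r.
by rewrite -[LHS]/(f N 0 u + f 0 N u) /f dN dN (lin0 Xl) !scaler0 addr0.
Qed.

Lemma qad_vanish X N n u : linear X -> N.-primitive_root q ->
  (forall v, iter N d v = 0) -> (N <= n)%N -> qad X n u = 0.
Proof.
move=> Xl qN dN; elim: n u => [|n IH] u.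
  by rewrite leqn0 => /eqP N0; move: (prim_order_gt0 qN); rewrite N0.
rewrite leq_eqVlt => /orP[/eqP<-|Nn]; first exact: qad_prim.
by rewrite qadS !IH // scaler0 (lin0 d_lin) subrr.
Qed.

Variable s : W -> W.
Hypothesis s_lin : linear s.
Hypothesis s_d : forall u, s (d u) = q *: d (s u).

(** Expresses through the twist [s] that the [n]-fold commutator has degree [n]: each [d]
    contributes one factor [q]. *)
Lemma qad_degree X n u : (forall v, s (X v) = X (s v)) -> linear X ->
  s (qad X n u) = q ^+ n *: qad X n (s u).
Proof.
move=> sX Xl; elim: n u => [|n IH] u; first by rewrite /= scale1r.
rewrite !qadS (linB s_lin) s_d IH (linZ s_lin) IH s_d (linZ d_lin).
rewrite (linZ (qad_linear n Xl)) scalerBr !scalerA.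
by rewrite exprS; congr (_ *: _ - _ *: _); ring.
Qed.

(** In the commutator, the terms where [d] falls on [z] cancel: passing [s] through the [n]-fold
    commutator produces exactly the weight [q ^+ n]. It serves twice, for right multiplication by
    [T] and then for the product itself. *)
Lemma qad_equivariant (Z : Type) (b : W -> Z -> W) (dZ : Z -> Z) X n u z :
  (forall z, linear (b^~ z)) ->
  (forall u z, d (b u z) = b (d u) z + b (s u) (dZ z)) ->
  (forall v, s (X v) = X (s v)) -> linear X ->
  (forall v z, X (b v z) = b (X v) z) ->
  qad X n (b u z) = b (qad X n u) z.
Proof.
move=> bl db sX Xl Xb; elim: n u z => [|n IH] u z; first exact: Xb.
have L := qad_linear n Xl.
rewrite !qadS (linB (bl z)) (linZ (bl z)) IH !db (linD L) !IH qad_degree //.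
rewrite (linZ (bl (dZ z))) scalerDr opprD addrACA.
by rewrite [X in _ + X]subrr addr0.
Qed.
(** The [q]-binomial formula with constant step [d]: at a primitive [N]-th root of unity the mixed
    terms disappear, so [d^N] is again a derivation, twisted by [s^N]. *)
Lemma iter_twisted_leibniz (Z : Type) (b : W -> Z -> W) (dZ : Z -> Z) N u z :
  (forall z, linear (b^~ z)) ->
  (forall u z, d (b u z) = b (d u) z + b (s u) (dZ z)) ->
  N.-primitive_root q ->
  iter N d (b u z) = b (iter N d u) z + b (iter N s u) (iter N dZ z).
Proof.
move=> bl db qN; pose f i j := b (iter i d (iter j s u)) (iter j dZ z).
have s_iter i v : s (iter i d v) = q ^+ i *: iter i d (s v).
  by elim: i => [|i IH] /=; rewrite ?scale1r // s_d IH (linZ d_lin) scalerA exprS.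
apply: (@qbinom_prim_expansion K q W (fun=> d) f (fun n => iter n d (b u z))) => //.
by move=> i j; rewrite /f db s_iter (linZ (bl _)).
Qed.
End QCommutator.

(** * Gradings *)

Section EigenGrading.
Variables (K : fieldType) (V : lmodType K) (gr : nat -> V -> Prop).
Hypothesis gr0 : forall n, gr n 0.
Hypothesis gr_lin : forall n a u v, gr n u -> gr n v -> gr n (a *: u + v).
Hypothesis gr_span : forall v, Defs.span (fun u => exists n, gr n u) v.
Variables (c : K) (h : V -> V).
Hypothesis c_inj : injective (GRing.exp c).
Hypothesis h_lin : linear h.
Hypothesis h_gr : forall n u, gr n u -> h u = c ^+ n *: u.

(** Independence of eigenspaces for the distinct eigenvalues [c ^+ n]: applying [h - c ^+ m] removes
    the last term and multiplies each other one by a nonzero scalar. *)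
Lemma gr_sum0 m (x : nat -> V) : (forall n, gr n (x n)) ->
  \sum_(n < m) x n = 0 -> forall n, (n < m)%N -> x n = 0.
Proof.
elim: m x => // m IH x xgr; rewrite big_ord_recr /= => xs0.
have grZ n a u : gr n u -> gr n (a *: u).
  by move=> un; rewrite -[_ *: _]addr0; exact: gr_lin.
have x0 n : (n < m)%N -> x n = 0.
  move=> nm; have /eqP : (c ^+ n - c ^+ m) *: x n = 0.
    apply: (IH (fun n => (c ^+ n - c ^+ m) *: x n)) => // [k|]; first exact: grZ.
    under eq_bigr => k _ do rewrite scalerBl -(h_gr (xgr k)).
    rewrite sumrB -(lin_sum h_lin) -scaler_sumr.
    move: xs0; move/eqP; rewrite addr_eq0 => /eqP ->.
    by rewrite -[- _]scaleN1r (linZ h_lin) (h_gr (xgr m)) !scalerA mulrC subrr.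
  rewrite scaler_eq0 subr_eq0 => /orP[/eqP/c_inj nE|/eqP//].
  by rewrite nE ltnn in nm.
move=> n; rewrite ltnS leq_eqVlt => /orP[/eqP->|]; last exact: x0.
by move: xs0; rewrite big1 ?add0r // => k _; exact: x0.
Qed.

Lemma sum_trunc (x : nat -> V) m M : (m <= M)%N ->
  (forall n, (m <= n)%N -> x n = 0) -> \sum_(n < M) x n = \sum_(n < m) x n.
Proof.
move=> mM xm; rewrite -!(big_mkord xpredT x) (big_cat_nat (leq0n m) mM) /=.
rewrite [X in _ + X]big_nat_cond [X in _ + X]big1 ?addr0 // => k.
by rewrite andbT => /andP[mk _]; exact: xm.
Qed.

Lemma eigen_grading : grading gr.
Proof.
split=> // v.
have [x [xgr [m [xm vE]]]] : exists x : nat -> V, (forall n, gr n (x n)) /\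
    (exists m, (forall n, (m <= n)%N -> x n = 0) /\ v = \sum_(n < m) x n).
  elim: (gr_span v) => [|a u w [n un] _ [x [xgr [m [xm ->]]]]].
    by exists (fun=> 0); split=> //; exists 0%N; rewrite big_ord0.
  exists (fun k => (if k == n then a else 0) *: u + x k); split=> [k|].
    case: eqP => [->|_]; first exact: gr_lin.
    by rewrite scale0r add0r.
  have mM : (m <= maxn m n.+1)%N by exact: leq_maxl.
  exists (maxn m n.+1); split=> [k|].
    rewrite geq_max => /andP[mk nk]; rewrite gtn_eqF // scale0r add0r; exact: xm.
  rewrite big_split /= (sum_trunc mM xm); congr (_ + _).
  have nM : (n < maxn m n.+1)%N by exact: leq_maxr.
  rewrite (bigD1 (Ordinal nM)) //= eqxx big1 ?addr0 // => k kn.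
  by rewrite ifN ?scale0r //; apply: contra kn => /eqP E; apply/eqP/val_inj.
exists x; split; first by split=> //; exists m.
move=> y [ygr [m' [ym' vE']]]; apply/funext => n.
(* A common length for both decompositions, also exceeding the index [n] under comparison. *)
pose M := maxn (maxn m m') n.+1.
have mM : (m <= M)%N by rewrite /M !leq_max leqnn.
have mM' : (m' <= M)%N by rewrite /M !leq_max leqnn orbT.
have nM : (n < M)%N by rewrite /M leq_max leqnn orbT.
apply/eqP; rewrite -subr_eq0; apply/eqP.
apply: (@gr_sum0 M (fun n => x n - y n)) => // [k|].
  by rewrite addrC -scaleN1r; exact: gr_lin.
by rewrite sumrB (sum_trunc mM xm) (sum_trunc mM' ym') -vE -vE' subrr.
Qed.
End EigenGrading.

(** * The space E and its tensor algebra *)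

Section DirectSum.
Variables (K : fieldType) (q : K) (A : lmodType K) (oneA : A).
Local Notation E := (Espace q oneA).
Local Notation dk := (@dk K q A oneA).

Lemma E_ind (P : E -> Prop) : P 0 ->
  (forall a u v, P u -> P v -> P (a *: u + v)) ->
  (forall k x, (0 < k)%N -> P (dk k x)) -> forall e, P e.
Proof.
move=> P0 PD Pdk e; have /asboolP[e0 [m em]] := E_valP e.
(* The index 0 can be omitted because it is never in range, so that [e 0 = 0]. *)
have -> : e = \sum_(k < m | (0 < k)%N) dk k (lrepr (e k)).
  apply: E_ext => j.
  have valS : forall (F : nat -> E), (\sum_(k < m | (0 < k)%N) F k : E) j =
      \sum_(k < m | (0 < k)%N) F k j.
    by move=> F; apply: (@lin_sum K _ _ (fun e : E => e j)) => a u v; exact: E_linearE.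
  rewrite (valS (fun k => dk k (lrepr (e k)))) /= /dk_fun.
  have [jr|jr] := boolP (in_range q j); last first.
    rewrite e0 // big1 // => k _; case: eqP => //= jk; rewrite -jk.
    by rewrite (negPf jr).
  have [jm|mj] := ltnP j m; last first.
    rewrite em // big1 // => k _; case: eqP => //= jk.
    by move: (ltn_ord k); rewrite -jk ltnNge mj.
  rewrite (bigD1 (Ordinal jm)) /=; last by case/andP: jr.
  rewrite eqxx jr /= lreprK big1 ?addr0 // => k /andP[_ kj].
  by case: eqP => //= jk; case/eqP: kj; exact: val_inj.
apply: (big_ind P) => // [u v Pu Pv|k k0]; last exact: Pdk.
by rewrite -[u]scale1r; exact: PD.
Qed.
End DirectSum.

(** * Linear maps out of the direct sum E *)

Section DirectSumLift.
Variables (K : fieldType) (q : K) (A : lmodType K) (oneA : A).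
Variables (W : lmodType K) (f : nat -> A -> W).
Local Notation E := (Espace q oneA).
Local Notation abar := (lproj (fun v : A => v = oneA)).
Hypothesis f_lin : forall k, linear (f k).
Hypothesis f_one : forall k, in_range q k -> f k oneA = 0.
Hypothesis f_out : forall k x, ~~ in_range q k -> f k x = 0.

Lemma f_lrepr k x : f k (lrepr (abar x)) = f k x.
Proof.
have [kr|kr] := boolP (in_range q k); last by rewrite !f_out.
apply/eqP; rewrite -subr_eq0 -(linB (f_lin k)); apply/eqP.
have : Defs.span (fun v => v = oneA) (lrepr (abar x) - x).
  by apply/lproj_eq; rewrite lreprK.
elim=> [|a u v -> _ IH]; first exact: lin0.
by rewrite f_lin f_one // IH scaler0 addr0.
Qed.

Lemma f_lrepr_linear k :
  linear (fun u : lquot (fun v : A => v = oneA) => f k (lrepr u)).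
Proof.
move=> a u v; rewrite -[u]lreprK -[v]lreprK -[X in lrepr X](linearP abar) !f_lrepr.
exact: f_lin.
Qed.

(** Membership in E only asserts that some bound on the support exists, hence the choice of one. *)
Definition E_bound (e : E) : nat := projT1 (cid (proj2 (asboolW (E_valP e)))).

Lemma E_boundP (e : E) k : (E_bound e <= k)%N -> e k = 0.
Proof. exact: (projT2 (cid (proj2 (asboolW (E_valP e))))). Qed.

Definition E_lift (e : E) : W := \sum_(k < E_bound e) f k (lrepr (e k)).

(** Independence of the chosen bound, which lets linearity be checked on a common one. *)
Lemma E_liftE (e : E) m : (forall k, (m <= k)%N -> e k = 0) ->
  E_lift e = \sum_(k < m) f k (lrepr (e k)).
Proof.
have H n n' : (n <= n')%N -> (forall k, (n <= k)%N -> e k = 0) ->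
    \sum_(k < n') f k (lrepr (e k)) = \sum_(k < n) f k (lrepr (e k)).
  move=> nn' en; apply: (sum_trunc (x := fun k => f k (lrepr (e k))) nn') => k nk.
  by rewrite en // (lin0 (@f_lrepr_linear k)).
rewrite /E_lift => em; case: (leqP m (E_bound e)) => [mb|/ltnW mb].
  exact: H.
by symmetry; apply: H => //; exact: E_boundP.
Qed.

Lemma E_lift_linear : linear E_lift.
Proof.
move=> a e e'; pose m := maxn (E_bound e) (E_bound e').
have He k : (m <= k)%N -> e k = 0 by rewrite geq_max => /andP[/E_boundP].
have He' k : (m <= k)%N -> e' k = 0 by rewrite geq_max => /andP[_ /E_boundP].
rewrite (E_liftE He) (E_liftE He') (@E_liftE _ m) => [|k mk]; last first.
  by rewrite E_linearE He // He' // scaler0 addr0.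
rewrite scaler_sumr -big_split; apply: eq_bigr => k _.
by rewrite E_linearE f_lrepr_linear.
Qed.

Lemma E_lift_dk k x : in_range q k -> E_lift (dk q oneA k x) = f k x.
Proof.
move=> kr; rewrite (@E_liftE _ k.+1) => [|j kj]; last first.
  by rewrite /= /dk_fun gtn_eqF.
rewrite big_ord_recr /= big1 ?add0r => [|j _].
  by rewrite /dk_fun eqxx kr f_lrepr.
rewrite /dk_fun ltn_eqF //; exact: (lin0 (@f_lrepr_linear j)).
Qed.

End DirectSumLift.

(** * Induction on a tensor algebra, and its representations *)

Section TensorInduction.
Variables (K : fieldType) (V : lmodType K).
Local Notation F := {malg K[{fmonom V}]}.
Local Notation T := (tens V).
Local Notation pi := (lproj (@tens_rel K V) : F -> T).

Lemma tens_ind (P : T -> Prop) :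
  P 0 -> (forall a u v, P u -> P v -> P (a *: u + v)) -> P 1 ->
  (forall e t, P t -> P (tgen e * t)) -> forall t, P t.
Proof.
move=> P0 PD P1 PM; elim/lquotP => x; elim/fword_ind: x => [|a u v Pu Pv|w].
- by rewrite (lin0 (linearP pi)).
- by rewrite (linearP pi); exact: PD.
elim: w => [|e w IH]; first by rewrite /fword big_nil.
by rewrite fword_cons; move: (PM e _ IH); rewrite tensM.
Qed.

Lemma tens_mulPl a (u v t : T) : (a *: u + v) * t = a *: (u * t) + v * t.
Proof. by rewrite mulrDl -scalerAl. Qed.

Lemma tens_mulPr a (u v t : T) : t * (a *: u + v) = a *: (t * u) + t * v.
Proof. by rewrite mulrDr -scalerAr. Qed.

Lemma tens_mulZl a (u t : T) : (a *: u) * t = a *: (u * t).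
Proof. by rewrite scalerAl. Qed.

Lemma tgen0M (t : T) : tgen (0 : V) * t = 0.
Proof. by rewrite (lin0 (@tgen_linear _ _)) mul0r. Qed.

Lemma tgenZM a (e : V) (t : T) : tgen (a *: e) * t = a *: (tgen e * t).
Proof. by rewrite (linZ (@tgen_linear _ _)) tens_mulZl. Qed.

Lemma tgenPM a (e e' : V) (t : T) :
  tgen (a *: e + e') * t = a *: (tgen e * t) + tgen e' * t.
Proof. by rewrite tgen_linear tens_mulPl. Qed.

Lemma tens_mul_linear_r (t : T) : linear (fun u => t * u).
Proof. by move=> a u v; exact: tens_mulPr. Qed.

Variables (W : lmodType K) (act : V -> W -> W).
Hypothesis act_linear_l : forall w, linear (act^~ w).
Hypothesis act_linear_r : forall e, linear (act e).

(** The action is first defined on the free algebra: a word composes the operators of its letters,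
    the last letter acting first. *)
Definition word_act (w : W) (x : F) : W :=
  malg_ext (fun m : {fmonom V} => foldr act w m) x.

Lemma word_act_linear w : linear (word_act w).
Proof. exact: malg_ext_linear. Qed.

Lemma word_act_word w r : word_act w (fword r) = foldr act w r.
Proof. exact: (malg_ext_fword (foldr act w)). Qed.

Lemma word_act_linear_r x : linear (word_act^~ x).
Proof.
move=> a u v; elim/fword_ind: x => [|b x y IHx IHy|r].
- by rewrite !(lin0 (word_act_linear _)) scaler0 addr0.
- by rewrite !word_act_linear IHx IHy !scalerDr !scalerA (mulrC a) addrACA.
by rewrite !word_act_word; elim: r => //= e r ->; rewrite act_linear_r.
Qed.

Lemma word_actM w x y : word_act w (x * y) = word_act (word_act w y) x.
Proof.
pose h (x y : F) := word_act w (x * y).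
pose h' (x y : F) := word_act (word_act w y) x.
apply: (@fword_ext2 K V W h h'); rewrite /h /h'.
- by move=> z a u v; rewrite mulF_linear_l word_act_linear.
- by move=> z a u v; rewrite (mulF_linear_r z a u v) word_act_linear.
- by move=> z a u v; rewrite word_act_linear.
- by move=> z a u v; rewrite word_act_linear word_act_linear_r.
by move=> r r'; rewrite -fword_cat !word_act_word foldr_cat.
Qed.

Lemma word_act_gen w e : word_act w (fgen e) = act e w.
Proof. by rewrite fword_seq1 word_act_word. Qed.

(** Linearity of [act] in the letter kills the middle factor of every relation, so the action
    descends to the tensor algebra. *)
Lemma word_act_rel w x : Defs.span (@tens_rel K V) x -> word_act w x = 0.
Proof.
elim=> [|b z u [x' y' a e f] _ IH]; first exact: (lin0 (word_act_linear w)).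
rewrite word_act_linear IH addr0 !word_actM /lin_rel.
rewrite (linB (word_act_linear _)) word_act_linear !word_act_gen act_linear_l subrr.
by rewrite (lin0 (word_act_linear_r x')) scaler0.
Qed.

Definition tens_act (t : T) (w : W) : W := word_act w (lrepr t).

Lemma tens_act_pi x w : tens_act (pi x) w = word_act w x.
Proof.
apply/eqP; rewrite -subr_eq0 -(linB (word_act_linear w)); apply/eqP.
by apply/word_act_rel/lproj_eq; rewrite lreprK.
Qed.

Lemma tens_act_linear_r t : linear (tens_act t).
Proof. exact: word_act_linear_r. Qed.

Lemma tens_act_linear_l w : linear (tens_act^~ w).
Proof.
move=> a; elim/lquotP => x; elim/lquotP => y.
by rewrite -(linearP pi) !tens_act_pi word_act_linear.
Qed.

Lemma tens_act1 w : tens_act 1 w = w.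
Proof. have N : fword [::] = 1 :> F by exact: big_nil.
by rewrite -[1]/(pi 1) -N tens_act_pi word_act_word. Qed.

Lemma tens_actM t t' w : tens_act (t * t') w = tens_act t (tens_act t' w).
Proof.
elim/lquotP: t => x; elim/lquotP: t' => y.
by rewrite tensM !tens_act_pi word_actM.
Qed.

Lemma tens_act_gen e w : tens_act (tgen e) w = act e w.
Proof. by rewrite /tgen tens_act_pi word_act_gen. Qed.

End TensorInduction.

(** * An axiomatic description of T(E) *)

Section DkAlgebra.
Variables (K : fieldType) (q : K) (A : lmodType K) (oneA : A).

(* The scaling by [c ^+ n] in degree [n], when [tk k x] generate [T] in degree [k]. *)
Record dilation (T : algType K) (tk : nat -> A -> T) (c : K) (h : T -> T) : Prop :=
  Dilation {
    dil_linear : linear h;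
    dil1 : h 1 = 1;
    dil_tkM : forall k x t, h (tk k x * t) = c ^+ k *: (tk k x * h t)
  }.

(* The properties of [T = T(E)], with [tk k x] for [d^k(x)], which determine
   the product on [A (x) T]: [dka_act] says that [T] is the algebra freely
   generated by the spaces [d^k(A)]. *)
Record dk_algebra (T : algType K) (tk : nat -> A -> T) (Td ts : T -> T)
    (Tgr : nat -> T -> Prop) : Prop := DkAlgebra {
  dka_one : forall k, tk k oneA = 0;
  dka_out : forall k x, ~~ in_range q k -> tk k x = 0;
  dka_ind : forall P : T -> Prop, P 0 ->
    (forall a u v, P u -> P v -> P (a *: u + v)) -> P 1 ->
    (forall k x t, (0 < k)%N -> P t -> P (tk k x * t)) -> forall t, P t;
  dka_act : forall (W : lmodType K) (f : nat -> A -> W -> W),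
    (forall k w, linear (fun x => f k x w)) -> (forall k x, linear (f k x)) ->
    (forall k w, in_range q k -> f k oneA w = 0) ->
    (forall k x w, ~~ in_range q k -> f k x w = 0) ->
    exists act : T -> W -> W,
      [/\ forall w, linear (act^~ w), forall t, linear (act t),
          forall w, act 1 w = w, forall t u w, act (t * u) w = act t (act u w)
        & forall k x w, (0 < k)%N -> act (tk k x) w = f k x w];
  dka_d_linear : linear Td;
  dka_dM : forall t u, Td (t * u) = Td t * u + ts t * Td u;
  dka_d : forall k x, (0 < k)%N -> Td (tk k x) = tk k.+1 x;
  dka_s : dilation tk q ts;
  dka_dil : forall c, exists h, dilation tk c h;
  dka_gr0 : forall n, Tgr n 0;
  dka_gr_lin : forall n a u v, Tgr n u -> Tgr n v -> Tgr n (a *: u + v);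
  dka_gr1 : Tgr 0%N 1;
  dka_gr_tkM : forall k n x t, Tgr n t -> Tgr (k + n)%N (tk k x * t);
  dka_gr_ind : forall P : nat -> T -> Prop, (forall n, P n 0) ->
    (forall n a u v, P n u -> P n v -> P n (a *: u + v)) -> P 0%N 1 ->
    (forall k x n t, Tgr n t -> P n t -> P (k + n)%N (tk k x * t)) ->
    forall n t, Tgr n t -> P n t
}.
End DkAlgebra.

(** * The concrete T(E) satisfies the axioms *)

Section TensorGrading.
Variables (K : fieldType) (q : K) (A : lmodType K) (oneA : A).
Local Notation E := (Espace q oneA).
Local Notation T := (tens E).
Local Notation dk := (dk q oneA).
Local Notation Tgr := (@Tgr K q A oneA).
Local Notation Td := (@Td K q A oneA).
Implicit Types (e : E) (t u v : T).

Lemma dk_out k x : ~~ in_range q k -> dk k x = 0.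
Proof.
by move=> /negPf kr; apply: E_ext => j; rewrite /= /dk_fun kr andbF.
Qed.

Lemma dk_one k : dk k oneA = 0.
Proof.
apply: E_ext => j; rewrite /= /dk_fun; case: ifP => // _.
by apply/lproj_eq0/Defs.span_gen.
Qed.

Lemma Egr_dk k e : Egr k e -> e = dk k (lrepr (e k)).
Proof.
move=> ek; apply: E_ext => j; rewrite /= /dk_fun.
have [->|/ek->//] := eqVneq j k; rewrite lreprK /=.
have /asboolP[e0 _] := E_valP e.
by case: ifP => // /negbT /e0.
Qed.

Lemma dk_gr k x : Egr k (dk k x).
Proof. by move=> j /negPf jk; rewrite /= /dk_fun jk. Qed.

Lemma Tgr0 n : Tgr n 0. Proof. exact: Defs.span0. Qed.

Lemma Tgr_lin n a u v : Tgr n u -> Tgr n v -> Tgr n (a *: u + v).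
Proof. exact: Defs.span_submod. Qed.

Lemma Tgr1 : Tgr 0 1.
Proof. by apply: Defs.span_gen; exists [::]; rewrite !big_nil. Qed.

Lemma Tgr_genM k n x t : Tgr n t -> Tgr (k + n) (tgen (dk k x) * t).
Proof.
apply: (lin_span (tens_mul_linear_r _)) => _ [w [wgr wn ->]].
apply: Defs.span_gen; exists ((k, dk k x) :: w); rewrite !big_cons wn; split=> // p.
by rewrite inE => /predU1P[->|/wgr//]; exact: dk_gr.
Qed.

(** A homogeneous element of E of degree [k] is [dk k] of a representative of its only component, so
    homogeneous words reduce to products of such generators. *)
Lemma Tgr_ind (P : nat -> T -> Prop) :
  (forall n, P n 0) ->
  (forall n a u v, P n u -> P n v -> P n (a *: u + v)) -> P 0%N 1 ->
  (forall k x n t, Tgr n t -> P n t -> P (k + n)%N (tgen (dk k x) * t)) ->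
  forall n t, Tgr n t -> P n t.
Proof.
move=> P0 PD P1 PM n t; elim=> // a {}t v [w [wgr wn ->]] _ IH.
apply: PD => // {v IH}; rewrite -wn {n wn}.
elim: w wgr => [|[k e] w IHw] wgr; first by rewrite !big_nil.
have wgr' p : p \in w -> Egr p.1 p.2 by move=> pw; apply: wgr; rewrite inE pw orbT.
have := Egr_dk (wgr (k, e) (mem_head _ _)); rewrite !big_cons /= => ->.
by apply: PM; [apply: Defs.span_gen; exists w|exact: IHw].
Qed.

Lemma Td_linear : linear Td.
Proof. exact: linearP. Qed.

Lemma Escale_dk k x : Escale (dk k x) = q ^+ k *: dk k x.
Proof.
apply: E_ext => j; rewrite -[RHS]/(q ^+ k *: dk k x j) /= /Escale_fun /= /dk_fun.
by case: eqP => [->//|_] /=; rewrite !scaler0.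
Qed.

(** The analogue of [Escale] for any scalar: the powers of [q] do not separate degrees when [q] is a
    root of unity. *)
Definition Edil (c : K) : E -> E := E_lift (fun k x => c ^+ k *: dk k x).

Lemma dk_scale_linear c k : linear (fun x => c ^+ k *: dk k x).
Proof. by move=> a x y; rewrite dk_linear scalerDr !scalerA mulrC. Qed.

Lemma dk_scale_one c k : in_range q k -> c ^+ k *: dk k oneA = 0.
Proof. by move=> _; rewrite dk_one scaler0. Qed.

Lemma dk_scale_out c k x : ~~ in_range q k -> c ^+ k *: dk k x = 0.
Proof. by move=> kr; rewrite dk_out ?scaler0. Qed.

Lemma Edil_linear c : linear (Edil c).
Proof.
exact: (E_lift_linear (dk_scale_linear c) (@dk_scale_one c) (@dk_scale_out c)).
Qed.

HB.instance Definition _ c := GRing.isLinear.Build K E E *:%R (Edil c) (Edil_linear c).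

Lemma Edil_dk c k x : Edil c (dk k x) = c ^+ k *: dk k x.
Proof.
have [kr|kr] := boolP (in_range q k).
  exact: (E_lift_dk (dk_scale_linear c) (@dk_scale_one c) (@dk_scale_out c)).
by rewrite dk_out // (lin0 (@Edil_linear c)) scaler0.
Qed.

Local Notation tk := (fun k x => tgen (dk k x) : T).

Lemma tsc_dilation c (s : {linear E -> E}) :
  (forall k x, s (dk k x) = c ^+ k *: dk k x) -> dilation tk c (tsc s).
Proof.
move=> sdk; split; [exact: linearP|exact: tsc1|move=> k x t].
by rewrite tscM tsc_gen sdk; exact: (tgenZM (c ^+ k) (dk k x)).
Qed.

Lemma tens_dk_ind (P : T -> Prop) : P 0 ->
  (forall a u v, P u -> P v -> P (a *: u + v)) -> P 1 ->
  (forall k x t, (0 < k)%N -> P t -> P (tgen (dk k x) * t)) -> forall t, P t.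
Proof.
move=> P0 PD P1 PM; apply: tens_ind => // e t Pt; move: e; apply: E_ind.
- by rewrite tgen0M.
- by move=> a e e' He He'; rewrite tgenPM; exact: PD.
by move=> k x k0; exact: PM.
Qed.

(** Two universal properties in succession: the operators [f k x] assemble into a linear action of
    E, which extends to a representation of its tensor algebra. *)
Lemma tens_dk_act (W : lmodType K) (f : nat -> A -> W -> W) :
  (forall k w, linear (fun x => f k x w)) -> (forall k x, linear (f k x)) ->
  (forall k w, in_range q k -> f k oneA w = 0) ->
  (forall k x w, ~~ in_range q k -> f k x w = 0) ->
  exists act : T -> W -> W,
    [/\ forall w, linear (act^~ w), forall t, linear (act t),
        forall w, act 1 w = w, forall t u w, act (t * u) w = act t (act u w)
      & forall k x w, (0 < k)%N -> act (tgen (dk k x)) w = f k x w].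
Proof.
move=> fl fr f1 fo.
pose Eact e w := E_lift (fun k x => f k x w) e.
have El w : linear (Eact^~ w).
  exact: (E_lift_linear (fl^~ w) (f1^~ w) (fun k x => fo k x w)).
have Er e : linear (Eact e).
  move=> a u v; rewrite /Eact /E_lift scaler_sumr -big_split; apply: eq_bigr => k _.
  exact: fr.
exists (tens_act Eact); split.
- exact: tens_act_linear_l.
- exact: tens_act_linear_r.
- exact: tens_act1.
- exact: tens_actM.
move=> k x w k0; rewrite tens_act_gen // /Eact.
have [kr|kr] := boolP (in_range q k).
  exact: (E_lift_dk (fl^~ w) (f1^~ w) (fun k x => fo k x w)).
by rewrite fo // dk_out //; exact: (lin0 (El w)).
Qed.

Lemma tens_dk_algebra : dk_algebra q oneA tk Td (tsc (@Escale K q A oneA)) Tgr.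
Proof.
split.
- by move=> k; rewrite dk_one; exact: (lin0 (@tgen_linear _ _)).
- by move=> k x kr; rewrite dk_out //; exact: (lin0 (@tgen_linear _ _)).
- exact: tens_dk_ind.
- exact: tens_dk_act.
- exact: Td_linear.
- exact: tderM.
- by move=> k x k0; rewrite Td_gen Ed_dk.
- exact/tsc_dilation/Escale_dk.
- by move=> c; exists (tsc (Edil c)); exact/tsc_dilation/Edil_dk.
- exact: Tgr0.
- exact: Tgr_lin.
- exact: Tgr1.
- by move=> k n x t; exact: Tgr_genM.
- exact: Tgr_ind.
Qed.

End TensorGrading.

(** * Consequences of the axioms: degrees and powers of the differential *)

Section DkAlgebraTheory.
Variables (K : fieldType) (q : K) (A : lmodType K) (oneA : A).
Variables (T : algType K) (tk : nat -> A -> T) (Td ts : T -> T).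
Variable (Tgr : nat -> T -> Prop).
Hypothesis HT : dk_algebra q oneA tk Td ts Tgr.
Implicit Types (t u v : T).

Let Td_lin : linear Td := dka_d_linear HT.
Let ts_lin : linear ts := dil_linear (dka_s HT).

Lemma mulP_l a t u v : (a *: u + v) * t = a *: (u * t) + v * t.
Proof. by rewrite mulrDl scalerAl. Qed.

Lemma mulP_r a t u v : t * (a *: u + v) = a *: (t * u) + t * v.
Proof. by rewrite mulrDr scalerAr. Qed.

Lemma dka_grZ n a t : Tgr n t -> Tgr n (a *: t).
Proof.
move=> tn; rewrite -[_ *: _]addr0; apply: (dka_gr_lin HT) => //.
exact: (dka_gr0 HT n).
Qed.

Lemma dka_grD n t u : Tgr n t -> Tgr n u -> Tgr n (t + u).
Proof. by move=> tn un; rewrite -[t]scale1r; exact: (dka_gr_lin HT). Qed.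

Lemma dka_tk0 x : tk 0 x = 0.
Proof. exact: (dka_out HT _). Qed.

Lemma dka_d1 : Td 1 = 0.
Proof.
have /eqP := dka_dM HT 1 1; rewrite !mulr1 (dil1 (dka_s HT)) mul1r.
by rewrite -subr_eq0 opprD addNKr oppr_eq0 => /eqP.
Qed.

Lemma dil_tk c h k x : dilation tk c h -> h (tk k x) = c ^+ k *: tk k x.
Proof. by move=> H; rewrite -[in LHS](mulr1 (tk k x)) (dil_tkM H) (dil1 H) mulr1. Qed.

Lemma dil_gr c h n t : dilation tk c h -> Tgr n t -> h t = c ^+ n *: t.
Proof.
move=> H; move: n t; apply: (dka_gr_ind HT) => [n|n a u v un vn||k x n t tn IH].
- by rewrite (lin0 (dil_linear H)) scaler0.
- by rewrite (dil_linear H) un vn scalerDr !scalerA mulrC.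
- by rewrite (dil1 H) scale1r.
by rewrite (dil_tkM H) IH -scalerAr scalerA exprD.
Qed.

Lemma dka_d_tkM k x t : (0 < k)%N ->
  Td (tk k x * t) = tk k.+1 x * t + q ^+ k *: (tk k x * Td t).
Proof.
by move=> k0; rewrite (dka_dM HT) (dka_d HT) // (dil_tk k x (dka_s HT)) scalerAl.
Qed.

Lemma dka_gr_d n t : Tgr n t -> Tgr n.+1 (Td t).
Proof.
move: n t; apply: (dka_gr_ind HT) => [n|n a u v un vn||k x n t tn IH].
- by rewrite (lin0 Td_lin); exact: (dka_gr0 HT _).
- by rewrite Td_lin; exact: (dka_gr_lin HT).
- by rewrite dka_d1; exact: (dka_gr0 HT _).
have [->|k0] := posnP k.
  by rewrite dka_tk0 mul0r (lin0 Td_lin); exact: (dka_gr0 HT _).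
rewrite dka_d_tkM //; apply: dka_grD; first rewrite -addSn.
  exact: (dka_gr_tkM HT _ _ tn).
by rewrite -addnS; apply: dka_grZ; exact: (dka_gr_tkM HT _ _ IH).
Qed.

Lemma dka_homogeneous_span t : Defs.span (fun v => exists n, Tgr n v) t.
Proof.
move: t; apply: (dka_ind HT) => [|a u v||k x t _].
- exact: Defs.span0.
- exact: Defs.span_submod.
- by apply: Defs.span_gen; exists 0%N; exact: (dka_gr1 HT).
apply: (lin_span (fun a u v => mulP_r a _ u v)) => v [n vn].
by apply: Defs.span_gen; exists (k + n)%N; exact: (dka_gr_tkM HT _ _ vn).
Qed.

Lemma dka_s_d t : ts (Td t) = q *: Td (ts t).
Proof.
have S := dka_s HT; move: t; apply: (dka_ind HT) => [|a u v Hu Hv||k x t k0 Ht].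
- by rewrite !(lin0 Td_lin, lin0 ts_lin) scaler0.
- by rewrite !(Td_lin, ts_lin) Hu Hv scalerDr !scalerA mulrC.
- by rewrite (dil1 S) dka_d1 (lin0 ts_lin) scaler0.
rewrite dka_d_tkM // (linD ts_lin) (linZ ts_lin) !(dil_tkM S) Ht (linZ Td_lin).
rewrite dka_d_tkM // -!scalerAr !scalerDr !scalerA exprS; congr (_ + _ *: _).
ring.
Qed.

Lemma iter_linear (W : lmodType K) (f : W -> W) n : linear f -> linear (iter n f).
Proof. by move=> fl; elim: n => // n IH a u v; rewrite !iterS IH fl. Qed.

(** By the twisted Leibniz rule for the [N]-th power, it suffices to treat 1 and the generators. *)
Lemma dka_iter_d N t : N.-primitive_root q -> iter N Td t = 0.
Proof.
move=> qN.
have L t u := iter_twisted_leibniz Td_lin dka_s_d t u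
  (fun z a t' u' => mulP_l a z t' u') (dka_dM HT) qN.
have Nl : linear (iter N Td) by exact: iter_linear.
move: t; apply: (dka_ind HT) => [|a u v Hu Hv||k x t k0 Ht].
- exact: (lin0 Nl).
- by rewrite Nl Hu Hv scaler0 addr0.
- have := prim_order_gt0 qN; case: (N) => // n _; rewrite iterSr dka_d1.
  exact: (lin0 (iter_linear n Td_lin)).
rewrite L Ht mulr0 addr0.
(* The index [N + k] exceeds [N - 1], hence is out of range. *)
have -> : iter N Td (tk k x) = tk (N + k)%N x.
  by elim: (N) => // n IH; rewrite iterS IH (dka_d HT) // addn_gt0 k0 orbT.
rewrite (dka_out HT) ?mul0r //; apply/negP => /andP[_ /asboolP/(_ N qN)].
by have := prim_order_gt0 qN; case: (N) => // n _; rewrite addSn ltnNge leq_addr.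
Qed.

End DkAlgebraTheory.

(** * The product on Omega *)

Section OmegaProduct.
Variables (K : fieldType) (q : K) (A : lmodType K) (mulA : A -> A -> A) (oneA : A).
Variables (T : algType K) (tk : nat -> A -> T) (Td ts : T -> T).
Variable (Tgr : nat -> T -> Prop).
Hypothesis HT : dk_algebra q oneA tk Td ts Tgr.
Hypothesis HA : unital_algebra mulA oneA.

Local Notation O := (tensor A T).
Local Notation ot := (@otimes K A T).
Implicit Types (t : T) (u v w : O) (x y : A).

Let Td_lin : linear Td := dka_d_linear HT.
Let ts_lin : linear ts := dil_linear (dka_s HT).

Let otl t : linear (ot^~ t) := otimes_linear_l t.
Let otr x : linear (ot x) := otimes_linear_r x.

Lemma tensor_eq (W : lmodType K) (f g : O -> W) : linear f -> linear g ->
  (forall x t, f (ot x t) = g (ot x t)) -> f =1 g.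
Proof.
move=> fl gl fg; apply: tensor_ind => // [|a u v fu fv].
  by rewrite (lin0 fl) (lin0 gl).
by rewrite fl gl fu fv.
Qed.

(** * Right multiplication by [T] and left multiplication by [A] *)

Lemma rmul_linear_l t' t : linear (fun x => ot x (t * t')).
Proof. exact: otl. Qed.

Lemma rmul_linear_r t' x : linear (fun t => ot x (t * t')).
Proof. by move=> a t u; rewrite mulP_l otr. Qed.

Definition rmul u t' : O := tensor_lift (rmul_linear_l t') (rmul_linear_r t') u.

Lemma rmulE x t t' : rmul (ot x t) t' = ot x (t * t').
Proof. exact: (tensor_liftE (rmul_linear_l t') (rmul_linear_r t')). Qed.

Lemma rmul_linear t' : linear (rmul^~ t').
Proof. exact: (tensor_lift_linear (rmul_linear_l t') (rmul_linear_r t')). Qed.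

Lemma lmul_linear_l y t : linear (fun x => ot (mulA y x) t).
Proof. by move=> a x z; rewrite (proj2 (ua_bilinear HA)) otl. Qed.

Lemma lmul_linear_r y x : linear (fun t => ot (mulA y x) t).
Proof. exact: otr. Qed.

Definition lmul y u : O := tensor_lift (lmul_linear_l y) (lmul_linear_r y) u.

Lemma lmulE y x t : lmul y (ot x t) = ot (mulA y x) t.
Proof. exact: (tensor_liftE (lmul_linear_l y) (lmul_linear_r y)). Qed.

Lemma lmul_linear y : linear (lmul y).
Proof. exact: (tensor_lift_linear (lmul_linear_l y) (lmul_linear_r y)). Qed.

Lemma lmul_linear_param u : linear (lmul^~ u).
Proof.
move=> a x y; move: u; apply: tensor_eq => [||z t].
- exact: lmul_linear.
- move=> b u v; rewrite !lmul_linear !scalerDr !scalerA (mulrC a); exact: addrACA.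
by rewrite !lmulE (proj1 (ua_bilinear HA)) otl.
Qed.

Lemma lmul1 u : lmul oneA u = u.
Proof.
move: u; apply: tensor_eq => // [|x t]; first exact: lmul_linear.
by rewrite lmulE (ua_left_unit HA).
Qed.

Lemma lmulM x y u : lmul (mulA x y) u = lmul x (lmul y u).
Proof.
move: u; apply: tensor_eq => [||z t]; first exact: lmul_linear.
  by apply: linear_comp; exact: lmul_linear.
by rewrite !lmulE (ua_assoc HA).
Qed.

Lemma lmul_rmul y u t : lmul y (rmul u t) = rmul (lmul y u) t.
Proof.
move: u; apply: tensor_eq => [||z t'].
- exact: (linear_comp (lmul_linear y) (rmul_linear t)).
- exact: (linear_comp (rmul_linear t) (lmul_linear y)).
by rewrite lmulE !rmulE lmulE.
Qed.

Section RightExtension.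
Variables (h : T -> T) (h_lin : linear h).

Lemma ext_linear_l t : linear (fun x => ot x (h t)).
Proof. exact: otl. Qed.

Lemma ext_linear_r x : linear (fun t => ot x (h t)).
Proof. exact: (linear_comp (otr x) h_lin). Qed.

Definition ext u : O := tensor_lift ext_linear_l ext_linear_r u.

Lemma extE x t : ext (ot x t) = ot x (h t).
Proof. exact: (tensor_liftE ext_linear_l ext_linear_r). Qed.

Lemma ext_linear : linear ext.
Proof. exact: (tensor_lift_linear ext_linear_l ext_linear_r). Qed.
End RightExtension.

(** * The differential as a twisted derivation, and its nilpotency *)

Variable d : O -> O.
Hypothesis d_lin : linear d.
Hypothesis dE : forall x t, d (ot x t) = ot oneA (tk 1 x * t) + ot x (Td t).

Local Notation s := (ext ts_lin).
Let s_lin : linear s := ext_linear ts_lin.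

Lemma s_lmul y u : s (lmul y u) = lmul y (s u).
Proof.
move: u; apply: tensor_eq => [||z t].
- exact: (linear_comp s_lin (lmul_linear y)).
- exact: (linear_comp (lmul_linear y) s_lin).
by rewrite lmulE !extE lmulE.
Qed.

Lemma s_d u : s (d u) = q *: d (s u).
Proof.
move: u; apply: tensor_eq => [||x t].
- exact: (linear_comp s_lin d_lin).
- by move=> a u v; rewrite s_lin d_lin scalerDr !scalerA (mulrC q).
rewrite extE !dE (linD s_lin) !extE (dil_tkM (dka_s HT)) (dka_s_d HT).
by rewrite !(linZ (otr _)) scalerDr expr1.
Qed.

Lemma d_rmul u t : d (rmul u t) = rmul (d u) t + rmul (s u) (Td t).
Proof.
move: u; apply: tensor_eq => [||x t'].
- exact: (linear_comp d_lin (rmul_linear t)).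
- by move=> a u v; rewrite d_lin s_lin !rmul_linear scalerDr; exact: addrACA.
rewrite extE !dE !rmulE dE (linD (rmul_linear t)) !rmulE (dka_dM HT) mulrA.
by rewrite (linD (otr _)) addrA.
Qed.

Lemma d_one t : d (ot oneA t) = ot oneA (Td t).
Proof. by rewrite dE (dka_one HT) mul0r (lin0 (otr _)) add0r. Qed.

(** Writing [ot x t] as [ot x 1] times [t] and using nilpotency on [T], only [d^N] of [ot x 1]
    remains; it is [ot oneA (tk N x)], which is out of range. *)
Lemma iter_d N u : N.-primitive_root q -> iter N d u = 0.
Proof.
move=> qN; have Nl : linear (iter N d) by exact: iter_linear.
move: u; apply: tensor_ind => [|a u v Hu Hv|x t]; first exact: (lin0 Nl).
  by rewrite Nl Hu Hv scaler0 addr0.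
rewrite -[t]mul1r -rmulE (iter_twisted_leibniz d_lin s_d _ _ rmul_linear d_rmul qN).
rewrite (dka_iter_d HT _ qN) (_ : rmul (iter N s _) 0 = 0) ?addr0; last first.
  move: (iter N s _); apply: tensor_eq => [||y t'].
  - exact: rmul_linear.
  - by move=> a u v; rewrite scaler0 addr0.
  by rewrite rmulE mulr0 (lin0 (otr _)).
suff -> : iter N d (ot x 1) = 0 by exact: (lin0 (rmul_linear t)).
have H n : iter n.+1 d (ot x 1) = ot oneA (tk n.+1 x).
  elim: n => [|n IH].
    by rewrite /= dE (dka_d1 HT) mulr1 (lin0 (otr _)) addr0.
  by rewrite iterS IH d_one (dka_d HT).
case: N qN {Nl} => [/prim_order_gt0//|N] qN; rewrite H (dka_out HT) ?(lin0 (otr _)) //.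
by apply/negP => /andP[_ /asboolP/(_ _ qN)]; rewrite ltnn.
Qed.

Lemma iter_d_eq0 N u : (0 < N)%N -> q ^+ N = 1 -> iter N d u = 0.
Proof.
move=> N0 qN; have [M qM /dvdnP[k NE]] := prim_order_exists N0 qN.
by move: N0; rewrite {}NE; case: k => [|k]; rewrite ?mul0n // mulSn iterD iter_d.
Qed.

(** The value 0 at [k = 0] meets the requirement of [dka_act] out of range, where [qad] would give
    [lmul x]. *)
Definition dk_op k x : O -> O :=
  if (0 < k)%N then qad q d (lmul x) k else fun=> 0.

Lemma qad_lmul_linear k x : linear (qad q d (lmul x) k).
Proof. exact: (qad_linear q d_lin k (lmul_linear x)). Qed.

Lemma qad_lmul_one k u : (0 < k)%N -> qad q d (lmul oneA) k u = 0.
Proof. by case: k => // k _; rewrite (qad_eq _ _ _ _ lmul1) qad_id. Qed.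

Lemma qad_lmul_out k x u : (0 < k)%N -> ~~ in_range q k ->
  qad q d (lmul x) k u = 0.
Proof.
(* A positive [k] is out of range only if [q] has some order [N] with [N <= k]. *)
move=> k0; rewrite /in_range k0 /= => /asboolPn/existsNP[N /not_implyP[qN /negP]].
rewrite -ltnNge => Nk.
apply: (qad_vanish d_lin u (lmul_linear x) qN); last by case: N Nk {qN}.
by move=> v; exact: iter_d.
Qed.

Lemma dka_op_exists : exists act : T -> O -> O,
  [/\ forall w, linear (act^~ w), forall t, linear (act t),
      forall w, act 1 w = w, forall t t' w, act (t * t') w = act t (act t' w)
    & forall k x w, (0 < k)%N -> act (tk k x) w = qad q d (lmul x) k w].
Proof.
have [|||k x w|act [H1 H2 H3 H4 H5]] := dka_act HT (W := O) (f := dk_op).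
- move=> k w; rewrite /dk_op; case: (0 < k)%N; last first.
    by move=> a u v; rewrite scaler0 addr0.
  exact: (qad_linear_param q d_lin k w lmul_linear_param).
- move=> k x; rewrite /dk_op; case: (0 < k)%N; last first.
    by move=> a u v; rewrite scaler0 addr0.
  exact: qad_lmul_linear.
- by move=> k w /andP[k0 _]; rewrite /dk_op k0 qad_lmul_one.
- by rewrite /dk_op; case: ifP => // k0 kr; exact: qad_lmul_out.
exists act; split=> // k x w k0; by rewrite H5 // /dk_op k0.
Qed.

(** * The product defined by a representation of [T] on Omega *)

Section ProductFromAction.
Variable L : T -> O -> O.
Hypothesis L_lin_l : forall w, linear (L^~ w).
Hypothesis L_lin_r : forall t, linear (L t).
Hypothesis L1 : forall w, L 1 w = w.
Hypothesis LM : forall t t' w, L (t * t') w = L t (L t' w).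
Hypothesis L_tk : forall k x w, (0 < k)%N -> L (tk k x) w = qad q d (lmul x) k w.

Lemma L_tkM k x t w : (0 < k)%N -> L (tk k x * t) w = qad q d (lmul x) k (L t w).
Proof. by move=> k0; rewrite LM L_tk. Qed.

Lemma L_rmul t u t' : L t (rmul u t') = rmul (L t u) t'.
Proof.
move: t u; apply: (dka_ind HT) => [|a t v Ht Hv||k x t k0 Ht] u.
- by rewrite !(lin0 (L_lin_l _)) (lin0 (rmul_linear t')).
- by rewrite !L_lin_l Ht Hv rmul_linear.
- by rewrite !L1.
rewrite !L_tkM // Ht.
apply: (qad_equivariant d_lin s_lin s_d k (L t u) t' rmul_linear d_rmul).
- exact: s_lmul.
- exact: lmul_linear.
by move=> v z; exact: lmul_rmul.
Qed.

(** Since [d] kills the unit, the subtracted term of each commutator vanishes there and only [d^k]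
    of [ot x 1] is left. *)
Lemma qad_lmul_unit k x : (0 < k)%N ->
  qad q d (lmul x) k (ot oneA 1) = ot oneA (tk k x).
Proof.
have d1 : d (ot oneA 1) = 0 by rewrite d_one (dka_d1 HT) (lin0 (otr _)).
elim: k => // -[_ _|k IH _].
  rewrite qadS d1 (lin0 (qad_lmul_linear 0 x)) scaler0 subr0 /= lmulE.
  by rewrite (ua_right_unit HA) dE (dka_d1 HT) mulr1 (lin0 (otr _)) addr0.
rewrite qadS d1 (lin0 (qad_lmul_linear k.+1 x)) scaler0 subr0 IH // d_one.
by rewrite (dka_d HT).
Qed.

Lemma L_unit t : L t (ot oneA 1) = ot oneA t.
Proof.
move: t; apply: (dka_ind HT) => [|a t v Ht Hv||k x t k0 Ht].
- by rewrite (lin0 (L_lin_l _)) (lin0 (otr _)).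
- by rewrite L_lin_l Ht Hv otr.
- by rewrite L1.
by rewrite LM Ht -[t in LHS]mul1r -rmulE L_rmul L_tk // qad_lmul_unit // rmulE.
Qed.

Lemma L_ot t t' : L t (ot oneA t') = ot oneA (t * t').
Proof. by rewrite -[t' in LHS]mul1r -rmulE L_rmul L_unit rmulE. Qed.

(** On a generator this is the definition of the next [q]-commutator, solved for [d] composed with
    the previous one; the induction handles products. *)
Lemma d_L t w : d (L t w) = L (Td t) w + L (ts t) (d w).
Proof.
have S := dka_s HT.
move: t w; apply: (dka_ind HT) => [|a t v Ht Hv||k x t k0 Ht] w.
- by rewrite !(lin0 Td_lin, lin0 ts_lin, lin0 (L_lin_l _), lin0 d_lin) addr0.
- rewrite Td_lin ts_lin !L_lin_l d_lin Ht Hv scalerDr; exact: addrACA.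
- by rewrite (dil1 S) (dka_d1 HT) (lin0 (L_lin_l _)) !L1 add0r.
rewrite (dka_d_tkM HT) // (dil_tkM S) (linD (L_lin_l _)) !(linZ (L_lin_l _)).
rewrite !L_tkM // qadS -addrA -scalerDr -(linD (qad_lmul_linear k x)) -Ht.
by rewrite subrK.
Qed.

Lemma omul_bilinear_l v t : linear (fun x => lmul x (L t v)).
Proof. exact: lmul_linear_param. Qed.

Lemma omul_bilinear_r v x : linear (fun t => lmul x (L t v)).
Proof. exact: (linear_comp (lmul_linear x) (L_lin_l v)). Qed.

Definition omul u v : O :=
  tensor_lift (omul_bilinear_l v) (omul_bilinear_r v) u.

Lemma omulE x t v : omul (ot x t) v = lmul x (L t v).
Proof. exact: (tensor_liftE (omul_bilinear_l v) (omul_bilinear_r v)). Qed.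

Lemma omul_linear_l v : linear (omul^~ v).
Proof. exact: (tensor_lift_linear (omul_bilinear_l v) (omul_bilinear_r v)). Qed.

Lemma omul_linear_r u : linear (omul u).
Proof.
move=> a v w; move: u; apply: tensor_eq => [||x t].
- exact: omul_linear_l.
- move=> b u u'; rewrite !omul_linear_l !scalerDr !scalerA (mulrC a); exact: addrACA.
by rewrite !omulE L_lin_r lmul_linear.
Qed.

Lemma d_omul u v : d (omul u v) = omul (d u) v + omul (s u) (d v).
Proof.
move: u; apply: tensor_eq => [||x t].
- exact: (linear_comp d_lin (omul_linear_l v)).
- move=> a u w; rewrite d_lin s_lin !omul_linear_l scalerDr; exact: addrACA.
(* The operator of [d x] is the commutator of [d] with left multiplication by [x]. *)
have d_lmul w : d (lmul x w) = L (tk 1 x) w + lmul x (d w).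
  by rewrite L_tk // qadS expr0 scale1r subrK.
rewrite extE dE (linD (omul_linear_l v)) !omulE lmul1 d_lmul d_L.
by rewrite (linD (lmul_linear x)) -LM addrA.
Qed.

Lemma omul_lmul x v w : omul (lmul x v) w = lmul x (omul v w).
Proof.
move: v; apply: tensor_eq => [||y t].
- exact: (linear_comp (omul_linear_l w) (lmul_linear x)).
- exact: (linear_comp (lmul_linear x) (omul_linear_l w)).
by rewrite lmulE !omulE lmulM.
Qed.

(** The Leibniz rule [d_omul] is available before associativity, so [qad_equivariant] applies with
    the product as right action: commutation passes from [lmul x] to its commutators with [d]. *)
Lemma omul_L t v w : omul (L t v) w = L t (omul v w).
Proof.
move: t v; apply: (dka_ind HT) => [|a t t' Ht Ht'||k x t k0 Ht] v.
- by rewrite !(lin0 (L_lin_l _)) (lin0 (omul_linear_l w)).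
- by rewrite !L_lin_l omul_linear_l Ht Ht'.
- by rewrite !L1.
rewrite !L_tkM // -Ht; symmetry.
apply: (qad_equivariant d_lin s_lin s_d k (L t v) w omul_linear_l d_omul).
- exact: s_lmul.
- exact: lmul_linear.
by move=> u z; rewrite omul_lmul.
Qed.

Lemma omulA : associative omul.
Proof.
move=> u v w; symmetry; move: u; apply: tensor_eq => [||x t].
- exact: (linear_comp (omul_linear_l w) (omul_linear_l v)).
- exact: omul_linear_l.
by rewrite !omulE omul_lmul omul_L.
Qed.

Lemma omul_ot_l x y t : omul (ot x 1) (ot y t) = ot (mulA x y) t.
Proof. by rewrite omulE L1 lmulE. Qed.

Lemma omul_ot_r x t t' : omul (ot x t) (ot oneA t') = ot x (t * t').
Proof. by rewrite omulE L_ot lmulE (ua_right_unit HA). Qed.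

Lemma omul_algebra : unital_algebra omul (ot oneA 1).
Proof.
split.
- by split; [exact: omul_linear_l|exact: omul_linear_r].
- exact: omulA.
- by move=> u; rewrite omulE L1 lmul1.
apply: tensor_eq => [||x t] //; first exact: omul_linear_l.
by rewrite omul_ot_r mulr1.
Qed.

(** * Homogeneity of the product and the grading of Omega *)

Definition ogr n : O -> Prop :=
  Defs.span (fun u => exists x t, Tgr n t /\ u = ot x t).

Lemma ogr_ot n x t : Tgr n t -> ogr n (ot x t).
Proof. by move=> tn; apply: Defs.span_gen; exists x, t. Qed.

Lemma ogr0 n : ogr n 0. Proof. exact: Defs.span0. Qed.

Lemma ogr_lin n a u v : ogr n u -> ogr n v -> ogr n (a *: u + v).
Proof. exact: Defs.span_submod. Qed.

Lemma ogrZ n a u : ogr n u -> ogr n (a *: u).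
Proof. by move=> un; rewrite -[_ *: _]addr0; apply: ogr_lin => //; exact: ogr0. Qed.

Lemma ogrD n u v : ogr n u -> ogr n v -> ogr n (u + v).
Proof. by move=> un vn; rewrite -[u]scale1r; exact: ogr_lin. Qed.

Lemma ogr_lmul n x u : ogr n u -> ogr n (lmul x u).
Proof.
apply: (lin_span (lmul_linear x)) => _ [y [t [tn ->]]].
by rewrite lmulE; exact: ogr_ot.
Qed.

Lemma ogr_d n u : ogr n u -> ogr n.+1 (d u).
Proof.
apply: (lin_span d_lin) => _ [x [t [tn ->]]]; rewrite dE.
apply: ogrD; apply: ogr_ot; last exact: (dka_gr_d HT).
by rewrite -add1n; exact: (dka_gr_tkM HT).
Qed.

Lemma ogr_ext c h (H : dilation tk c h) n u :
  ogr n u -> ext (dil_linear H) u = c ^+ n *: u.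
Proof.
elim=> [|a w v [x [t [tn ->]]] _ IH].
  by rewrite (lin0 (ext_linear _)) scaler0.
rewrite ext_linear IH extE (dil_gr HT H tn) (linZ (otr _)) scalerDr !scalerA.
by rewrite mulrC.
Qed.

(** Left multiplication has degree 0, and each commutator inserts one [d], on one side or the
    other. *)
Lemma ogr_qad k n x u : ogr n u -> ogr (k + n)%N (qad q d (lmul x) k u).
Proof.
elim: k n u => [|k IH] n u un; first exact: ogr_lmul.
rewrite qadS -scaleNr; apply: ogrD; first by rewrite addSn; exact/ogr_d/IH.
by rewrite addSn -addnS; apply/ogrZ/IH/ogr_d.
Qed.

Lemma ogr_L m n t u : Tgr m t -> ogr n u -> ogr (m + n)%N (L t u).
Proof.
move=> tm un; move: m t tm; apply: (dka_gr_ind HT) => [m|m a t v tm vm||k x m t _ IH].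
- by rewrite (lin0 (L_lin_l _)); exact: ogr0.
- by rewrite L_lin_l; exact: ogr_lin.
- by rewrite L1.
have [->|k0] := posnP k.
  by rewrite (dka_tk0 HT) mul0r (lin0 (L_lin_l _)); exact: ogr0.
by rewrite L_tkM // -addnA; exact: ogr_qad.
Qed.

Lemma omul_graded : graded_product ogr omul.
Proof.
move=> m n u v um vn; move: um.
apply: (lin_span (omul_linear_l v)) => _ [x [t [tm ->]]].
by rewrite omulE; apply: ogr_lmul; exact: ogr_L.
Qed.

Lemma omul_leibniz : q_leibniz q ogr omul d.
Proof.
move=> n u v un; rewrite d_omul; congr (_ + _).
by rewrite (ogr_ext (dka_s HT) un) (linZ (omul_linear_l _)).
Qed.

Lemma ogr_grading (c : K) : injective (GRing.exp c) -> grading ogr.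
Proof.
move=> c_inj; have [h H] := dka_dil HT c.
apply: (@eigen_grading K O ogr ogr0 ogr_lin _ c _ c_inj (ext_linear (dil_linear H))).
  apply: tensor_ind => [|a u v|x t]; first exact: Defs.span0.
    exact: Defs.span_submod.
  apply: (lin_span (otr x)) (dka_homogeneous_span HT t) => u [n un].
  by apply: Defs.span_gen; exists n; exact: ogr_ot.
exact: ogr_ext.
Qed.

(** The bimodule rules determine left multiplication by [A], the Leibniz rule then by each [d^k(x)],
    and associativity by all of [T] and Omega. *)
Lemma omul_unique (mul : O -> O -> O) :
  bilinear_product mul -> associative mul ->
  (forall y x t, mul (ot y 1) (ot x t) = ot (mulA y x) t) ->
  (forall x t t', mul (ot x t) (ot oneA t') = ot x (t * t')) ->
  q_leibniz q ogr mul d -> omul = mul.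
Proof.
move=> [mul_l mul_r] mulA' mul_ot_l mul_ot_r leib.
have mul_lmul x v : mul (ot x 1) v = lmul x v.
  move: v; apply: tensor_eq => [||y t]; [exact: mul_r|exact: lmul_linear|].
  by rewrite mul_ot_l lmulE.
(* The Leibniz rule, solved for the term containing the differential of the left factor, is the
   recursion defining [qad]. *)
have mul_qad k x v : mul (iter k d (ot x 1)) v = qad q d (lmul x) k v.
  have gr_k j : ogr j (iter j d (ot x 1)).
    by elim: j => [|j IH]; [exact/ogr_ot/(dka_gr1 HT)|exact: ogr_d].
  elim: k v => [|k IH] v; first exact: mul_lmul.
  by rewrite qadS -!IH (leib _ _ _ (gr_k k)) addrK.
have mul_L t v : mul (ot oneA t) v = L t v.
  move: t v; apply: (dka_ind HT) => [|a t t' Ht Ht'||k x t k0 Ht] v.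
  - by rewrite (lin0 (otr _)) (lin0 (mul_l v)) (lin0 (L_lin_l v)).
  - by rewrite otr mul_l L_lin_l Ht Ht'.
  - by rewrite mul_lmul lmul1 L1.
  rewrite L_tkM // -mul_ot_r -mulA' Ht -mul_qad; congr (mul _ _).
  (* Evaluating [mul_qad] at the unit identifies [ot oneA (tk k x)] with [d^k] of [ot x 1], up to
     the right unit law. *)
  rewrite -qad_lmul_unit // -mul_qad.
  by move: (iter k d _); apply: tensor_eq => // y t'; rewrite mul_ot_r mulr1.
apply/funext => u; apply/funext => v; move: u.
apply: tensor_eq => [||x t]; [exact: omul_linear_l|exact: mul_l|].
rewrite omulE -mul_L -mul_lmul mulA'; congr (mul _ _).
by rewrite mul_ot_l (ua_right_unit HA).
Qed.

End ProductFromAction.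

(** The scalar [c] serves only to separate degrees, through the dilation that acts as [c ^+ n] in
    degree [n]. *)
Lemma ex_unique_omega_product (c : K) : injective (GRing.exp c) ->
  exists mul : O -> O -> O,
    unique (fun mul => [/\ bilinear_product mul, associative mul,
      (forall y x t, mul (ot y 1) (ot x t) = ot (mulA y x) t) /\
      (forall x t t', mul (ot x t) (ot oneA t') = ot x (t * t')),
      graded_product ogr mul & q_leibniz q ogr mul d]) mul /\
    graded_qdiff_algebra q ogr mul (ot oneA 1) d.
Proof.
move=> c_inj; have [L [Ll Lr L1 LM Ltk]] := dka_op_exists.
pose mul := omul Ll; exists mul.
have mul_alg : unital_algebra mul (ot oneA 1) by exact: omul_algebra.
have mul_gr : graded_product ogr mul by exact: omul_graded.
have mul_leib : q_leibniz q ogr mul d by exact: omul_leibniz.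
have mul_ot_l y x t : mul (ot y 1) (ot x t) = ot (mulA y x) t by exact: omul_ot_l.
have mul_ot_r x t t' : mul (ot x t) (ot oneA t') = ot x (t * t') by exact: omul_ot_r.
have mul_unique := omul_unique Ll L1 LM Ltk.
split; first split.
- split; [exact: (ua_bilinear mul_alg)|exact: (ua_assoc mul_alg)|by split| |].
    exact: mul_gr.
  exact: mul_leib.
- by move=> mul' [bil ass [ol or] _ leib]; exact: mul_unique.
split.
- exact: mul_alg.
- exact: (ogr_grading c_inj).
- exact/ogr_ot/(dka_gr1 HT).
- exact: mul_gr.
- exact: d_lin.
- exact: ogr_d.
- exact: mul_leib.
by move=> N N0 qN u; exact: iter_d_eq0.
Qed.

End OmegaProduct.

Theorem lemma4 (R : realType) (q : R[i]) (A : lmodType R[i])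
    (mulA : A -> A -> A) (oneA : A) :
  q != 0 -> unital_algebra mulA oneA ->
  exists mul : Omega q oneA -> Omega q oneA -> Omega q oneA,
    unique (Omega_product q oneA mulA) mul /\
    graded_qdiff_algebra q (Ogr q oneA) mul (ot oneA 1) (Od q oneA).
Proof.
move=> _ HA.
(* Degrees are separated by the powers of 2, which stay distinct whatever [q] is. *)
have two_inj : injective (GRing.exp (2 : R[i])).
  by apply: Num.Theory.ieexprIn; rewrite ?Num.Theory.ltr0n // Num.Theory.pnatr_eq1.
have HT := tens_dk_algebra q oneA.
exact: (ex_unique_omega_product HT HA
  (@Od_linear _ q A oneA) (@OdE _ q A oneA) two_inj).
Qed.
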